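(* For every $h\in C_\mathbb{R}([-R,R]^n)$ and every $\mu_1,\dots,\mu_n\in\mathrm{Prob}([-R,R])$, $$P(h)\ge P_\mathrm{sym}(h:\mu_1,\dots,\mu_n)+\sum_{i=1}^nH(\mu_i).$$ Moreover the following are equivalent: (i) $P(h)=P_\mathrm{sym}(h:\mu_1,\dots,\mu_n)+\sum_{i=1}^nH(\mu_i)$; (ii) $\mu_1,\dots,\mu_n$ are the marginals of the Gibbs measure $\mu_h$ associated with $h$; (iii) for each $i=1,\dots,n$, $\mu_i$ is the Gibbs measure on $[-R,R]$ associated with $h_i\in C_\mathbb{R}([-R,R])$, where $$h_i(x)=\log\int_{[-R,R]^{n-1}}e^{h(x_1,\dots,x_{i-1},x,x_{i+1},\dots,x_n)}\,dx_1\cdots dx_{i-1}dx_{i+1}\cdots dx_n.$$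
   Context: Fix $R>0$ and $n\in\mathbb{N}$. $\mathrm{Prob}([-R,R]^k)$ denotes Borel probability measures on $[-R,R]^k$; $C_\mathbb{R}([-R,R]^k)$ the real continuous functions with sup-norm. The Boltzmann–Gibbs entropy of $\mu\in\mathrm{Prob}([-R,R]^k)$ is $H(\mu)=-\int p\log p\,d\mathbf{x}$ if $\mu$ has a density $p$ with respect to Lebesgue measure, and $H(\mu)=-\infty$ otherwise. The pressure of $h\in C_\mathbb{R}([-R,R]^k)$ is $P(h)=\log\int_{[-R,R]^k}e^{h(\mathbf{x})}d\mathbf{x}$, and the Gibbs measure associated with $h$ is $d\mu_h=e^{-P(h)}e^{h(\mathbf{x})}d\mathbf{x}$. Marginals are images under coordinate projections. For $\mathbf{x}\in\mathbb{R}^N$ let $\kappa_N(\mathbf{x})=\frac1N\sum_jx_j$ (powers coordinatewise); $[-R,R]_\le^N$ is the set of vectors in $[-R,R]^N$ with nondecreasing coordinates; $S_N$ acts by $\sigma(\mathbf{x})=(x_{\sigma^{-1}(1)},\dots,x_{\sigma^{-1}(N)})$. An approximating sequence for $(\mu_1,\dots,\mu_n)$ is $\Xi(N)=(\xi_1(N),\dots,\xi_n(N))$ with $\xi_i(N)\in[-R,R]_\le^N$ and $\kappa_N(\xi_i(N)^k)\to\int x^k\,d\mu_i$ for all $k$. For $h\in C_\mathbb{R}([-R,R]^n)$, $\kappa_N(h(\mathbf{x}_1,\dots,\mathbf{x}_n))=\frac1N\sum_{j=1}^Nh(x_{1j},\dots,x_{nj})$. The mutual pressure is $$P_\mathrm{sym}(h:\mu_1,\dots,\mu_n)=\limsup_{N\to\infty}\frac1N\log\Biggl[\frac1{(N!)^n}\sum_{\sigma_1,\dots,\sigma_n\in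 S_N}\exp\bigl(N\kappa_N(h(\sigma_1(\xi_1(N)),\dots,\sigma_n(\xi_n(N))))\bigr)\Biggr]$$ (independent of the approximating sequence). *)

(* Defs.v *)
From HB Require Import structures.
From mathcomp Require Import all_boot all_order all_algebra all_fingroup.
From mathcomp Require Import all_classical all_reals all_analysis.
Set Implicit Arguments. Unset Strict Implicit. Unset Printing Implicit Defensive.
Import Order.TTheory GRing.Theory Num.Theory.
Import numFieldNormedType.Exports.
Local Open Scope classical_set_scope.
Local Open Scope ring_scope.

Section Defs.
Variables (R : realType) (r : R).
(* r is the radius called R in the paper; the cube is [-r,r]^n *)

Definition lam := @lebesgue_measure R.

Definition Ir : set R := `[-r, r].

Definition cube (n : nat) : set 'rV[R]_n :=
  [set x | forall i : 'I_n, x ord0 i \in `[-r, r]].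

Fixpoint iint_aux (m : nat) (S : pred nat) (F : (nat -> R) -> \bar R)
    (s : nat -> R) : \bar R :=
  match m with
  | 0 => F s
  | m'.+1 =>
      if S m' then
        (\int[lam]_(x in Ir) iint_aux m' S F
            (fun k => if k == m' then x else s k))%E
      else iint_aux m' S F s
  end.

(* Integral over [-r,r]^n w.r.t. n-dimensional Lebesgue measure of a
   nonnegative function, computed as iterated one-dimensional Lebesgue
   integrals (Tonelli). *)
Definition cube_int (n : nat) (f : 'rV[R]_n -> \bar R) : \bar R :=
  iint_aux n predT (fun s => f (\row_(i < n) s i)) (fun _ => 0).

Definition pressure (n : nat) (h : 'rV[R]_n -> R) : R :=
  ln (fine (cube_int (fun x => (expR (h x))%:E))).

Definition gibbs_marginal (n : nat) (h : 'rV[R]_n -> R) (i : 'I_n)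
    (A : set R) : \bar R :=
  ((expR (- pressure h))%:E *
   cube_int (fun x => (\1_A (x ord0 i) * expR (h x))%:E))%E.

Definition pressure1 (g : R -> R) : R :=
  ln (fine (\int[lam]_(x in Ir) (expR (g x))%:E))%E.

Definition gibbs1 (g : R -> R) (A : set R) : \bar R :=
  ((expR (- pressure1 g))%:E *
   \int[lam]_(x in A `&` Ir) (expR (g x))%:E)%E.

Definition hmarg (n : nat) (h : 'rV[R]_n -> R) (i : 'I_n) (x : R) : R :=
  ln (fine (iint_aux n (fun k => k != nat_of_ord i)
                (fun s => (expR (h (\row_(j < n) s j)))%:E) (fun _ => x))).

(* Prob([-r,r]): Borel probability measures on R concentrated on [-r,r] *)
Definition prob_on_cube (mu : probability (measurableTypeR R) R) : Prop :=
  mu Ir = 1%E.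

Definition is_density (mu : probability (measurableTypeR R) R) (p : R -> R) :=
  measurable_fun setT p /\ (forall x, 0 <= p x) /\
  forall A : set R, measurable A ->
    mu A = (\int[lam]_(x in A `&` Ir) (p x)%:E)%E.

Definition entropy (mu : probability (measurableTypeR R) R) : \bar R :=
  match pselect (exists p, is_density mu p) with
  | left e => (- \int[lam]_(x in Ir) (projT1 (cid e) x *
                                            ln (projT1 (cid e) x))%:E)%E
  | right _ => (-oo)%E
  end.

Definition approx_seq (n : nat) (mu : 'I_n -> probability (measurableTypeR R) R)
    (Xi : forall N : nat, 'I_n -> 'I_N -> R) : Prop :=
  (forall N i j, Xi N i j \in `[-r, r]) /\
  (forall N i (j k : 'I_N), (j <= k)%N -> Xi N i j <= Xi N i k) /\
  (forall i (k : nat),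
     (fun N : nat => ((N%:R)^-1 * \sum_(j < N) Xi N i j ^+ k)%:E) @ \oo -->
     (\int[mu i]_x (x ^+ k)%:E)%E).

(* mutual pressure P_sym(h : mu_1,...,mu_n) computed along Xi;
   sigma(x)_j = x_{sigma^-1(j)} *)
Definition mutual_pressure (n : nat) (h : 'rV[R]_n -> R)
    (Xi : forall N : nat, 'I_n -> 'I_N -> R) : \bar R :=
  limn_esup (fun N : nat =>
    ((N%:R)^-1 *
     ln ((N`!%:R ^+ n)^-1 *
         \sum_(s : {ffun 'I_n -> 'S_N})
           expR (\sum_(j < N)
                   h (\row_(i < n) Xi N i ((s i)^-1%g j)))))%:E).

End Defs.

Arguments cube {R} r n.

(* Main.v *)
(* Cut [-r, r] into cells of length [l] and replace [h] by a function [f] of cells.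
   Permutation averages change only by a factor [e^(o(N))] when the cell frequencies of
   the points change by [o(1)], so such an average is comparable with its mean over all
   configurations whose [i]-th frequencies are close to [q_i := mu_i(cells)]; that mean
   is a sum of [e^f] over typical configurations, with no permutation left, divided by
   the number of typical configurations.  A Chernoff bound shows that this number is
   [exp (N (sum_i H(q_i) + o(1)))].  As the sum is at most [(sum_a e^(f a))^N], and
   [sum_i H(q_i)] is at least [sum_i H(mu_i) - n ln l] (Jensen), this gives the inequality.
   When the [q_i] are the marginals of the discrete Gibbs weights [e^f], typical
   configurations carry at least half of [(sum_a e^(f a))^N], and equality follows.
   Conversely, adding [t p(x_i)] to [h] shifts the mutual pressure by [t int p dmu_i];
   if equality holds at [h], then [t |-> P(h + t p(x_i))] lies above a line of slope
   [int p dmu_i] through its value at [t = 0], so this slope is the derivative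
   [int p(x_i) dmu_h].  Hence [mu_i] has the moments of the [i]-th Gibbs marginal. *)

Require Import Defs.
From HB Require Import structures.
From mathcomp Require Import all_boot all_order all_algebra all_fingroup.
From mathcomp Require Import all_classical all_reals all_analysis.
From mathcomp Require Import measurable_realfun.
From mathcomp Require Import ring lra.
Set Implicit Arguments. Unset Strict Implicit. Unset Printing Implicit Defensive.
Import Order.TTheory GRing.Theory Num.Theory.
Import numFieldNormedType.Exports.
Local Open Scope classical_set_scope.
Local Open Scope ring_scope.

(** * Averages over permutations of finite configurations *)

Section Shuffle.
Variables (R : realType) (n N K : nat).
Local Notation word := {ffun 'I_n -> 'I_K}.
Local Notation conf := {ffun 'I_N -> word}.
Implicit Types (c d : conf) (s t : {ffun 'I_n -> 'S_N}) (f : word -> R).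

(** If some [mu i] has entropy $-\infty$, the right side is $-\infty$ while $P(h)$ is real, so the
    inequality holds and equality fails. Otherwise every [mu i] has a density. The grid relies on
    this: convergent moments control the frequency of a cell only if the cell endpoints carry no
    mass. The cell length $l$ is small but fixed while $N \to \infty$. The discrete pressure is
    $P(h) - n\ln l$, and this shift cancels exactly the $\ln l$ terms of the $n$ entropies, so no
    limit in $l$ is taken. All estimates hold at every large $N$, and the limsup is taken only at
    the end. The integrals over the cube are iterated, so no product measure appears. Clamping each
    coordinate to $[-r,r]$ turns $h$ into a uniformly continuous function of sequences, a class
    stable under integration in one variable, and the order of integration is exchanged through
    Riemann sums. Polynomials suffice as tilts because the moments determine a measure on a bounded
    interval. They are also all that the approximating sequence controls directly; the passage to
    cells goes through polynomials close to step functions. *)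

Definition shuffle s d : conf := [ffun j => [ffun i => d ((s i)^-1%g j) i]].
Definition occ d i b : nat := #|[pred j | d j i == b]|.
Definition mism c d i : nat := #|[pred j | c j i != d j i]|.
Definition energy f d : R := \sum_(j < N) f (d j).
(** Discrete counterpart of the bracket inside the mutual pressure: [f] stands for $h$ and words of
    cells stand for points. *)
Definition avgexp f d : R :=
  (N`!%:R ^+ n)^-1 * \sum_s expR (energy f (shuffle s d)).

Lemma shuffleM s t d :
  shuffle s (shuffle t d) = shuffle [ffun i => (t i * s i)%g] d.
Proof. by apply/ffunP => j; apply/ffunP => i; rewrite !ffunE invMg permM. Qed.

Lemma shuffle1 d : shuffle [ffun=> 1%g] d = d.
Proof. by apply/ffunP => j; apply/ffunP => i; rewrite !ffunE invg1 perm1. Qed.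

Lemma shuffleK s : cancel (shuffle s) (shuffle [ffun i => (s i)^-1%g]).
Proof.
move=> d; rewrite shuffleM -[RHS]shuffle1; congr shuffle.
by apply/ffunP => i; rewrite !ffunE mulgV.
Qed.

Lemma shuffleVK s : cancel (shuffle [ffun i => (s i)^-1%g]) (shuffle s).
Proof.
move=> d; rewrite shuffleM -[RHS]shuffle1; congr shuffle.
by apply/ffunP => i; rewrite !ffunE mulVg.
Qed.

Lemma card_perm_pred (u : 'S_N) (P : pred 'I_N) :
  #|[pred j | P (u^-1%g j)]| = #|[pred j | P j]|.
Proof.
rewrite -(fintype.card_image (@perm_inj _ u) [pred j | P j]); apply: eq_card => j.
rewrite inE; apply/idP/idP => [Pj|/fintype.imageP[k Pk ->]]; last by rewrite permK.
by apply/fintype.imageP; exists (u^-1%g j); rewrite // permKV.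
Qed.

Lemma occ_shuffle s d i b : occ (shuffle s d) i b = occ d i b.
Proof.
rewrite -[RHS](card_perm_pred (s i) (fun j => d j i == b)).
by apply: eq_card => j; rewrite !inE !ffunE.
Qed.

Lemma mism_shuffle s c d i : mism (shuffle s c) (shuffle s d) i = mism c d i.
Proof.
rewrite -[RHS](card_perm_pred (s i) (fun j => c j i != d j i)).
by apply: eq_card => j; rewrite !inE !ffunE.
Qed.

Lemma avgexp_shuffle f t d : avgexp f (shuffle t d) = avgexp f d.
Proof.
rewrite /avgexp; congr (_ * _).
rewrite [RHS](reindex (fun s : {ffun 'I_n -> 'S_N} => [ffun i => (t i * s i)%g])) /=.
  by apply: eq_bigr => s _; rewrite shuffleM.
exists (fun s : {ffun 'I_n -> 'S_N} => [ffun i => ((t i)^-1 * s i)%g]) => s _.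
  by apply/ffunP => i; rewrite !ffunE mulKg.
by apply/ffunP => i; rewrite !ffunE mulKVg.
Qed.

(** Each shuffle is a bijection of [D], so all $(N!)^n$ choices of permutations contribute the same
    sum. *)
Lemma sum_avgexp f (D : pred conf) : (forall s d, D (shuffle s d) = D d) ->
  \sum_(d | D d) avgexp f d = \sum_(d | D d) expR (energy f d).
Proof.
move=> Dinv; rewrite -mulr_sumr exchange_big /=.
rewrite (eq_bigr (fun=> \sum_(d | D d) expR (energy f d))); last first.
  move=> s _; rewrite [RHS](reindex (shuffle s)) /=; last first.
    by exists (shuffle [ffun i => (s i)^-1%g]) => d _; rewrite ?shuffleK ?shuffleVK.
  by apply: eq_bigl => d; rewrite Dinv.
rewrite sumr_const card_ffun card_Sn card_ord -[X in _ * X]mulr_natl natrX mulKf //.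
Qed.

(** A position where the two words differ costs at most [2 * M] and is counted by [mism] for at
    least one coordinate. *)
Lemma energy_mism f (M : R) c d : (forall a, `|f a| <= M) ->
  energy f c <= energy f d + 2 * M * \sum_i (mism c d i)%:R.
Proof.
move=> fM; rewrite /energy -lerBlDl -sumrB.
have -> : \sum_i (mism c d i)%:R = \sum_(j < N) \sum_i (c j i != d j i)%:R :> R.
  rewrite exchange_big; apply: eq_bigr => i _.
  by rewrite /mism -sum1_card natr_sum big_mkcond /=; apply: eq_bigr => j _; rewrite inE; case: ifP.
rewrite mulr_sumr; apply: ler_sum => j _.
have M0 : 0 <= M by apply: le_trans (fM (c j)).
have [->|cd] := eqVneq (c j) (d j).
  by rewrite subrr mulr_ge0 ?mulr_ge0 ?sumr_ge0.
have [i ci] : exists i, c j i != d j i.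
  apply/existsP; rewrite -negb_forall; apply: contra cd => /forallP E.
  by apply/eqP/ffunP => i; apply/eqP.
have s1 : 1 <= \sum_i (c j i != d j i)%:R :> R.
  by rewrite (bigD1 i) //= ci lerDl sumr_ge0.
have := fM (c j); have := fM (d j); rewrite !ler_norml => /andP[? ?] /andP[? ?].
apply: (@le_trans _ _ (2 * M)); first lra.
by rewrite ler_peMr // mulr_ge0.
Qed.

End Shuffle.

(** For a permutation with the fewest mismatches, a letter [b] that still has a bad position is
    never put by [c] where [d] has another letter. Its bad positions are then at most the excess of
    [d] over [c] in [b]; by truncated subtraction, letters in which [c] is richer contribute 0. *)
Lemma min_mismatch_perm (N K : nat) (c d : 'I_N -> 'I_K) :
  exists t : 'S_N, (#|[pred j | c (t j) != d j]| <=
    \sum_b (#|[pred j | d j == b]| - #|[pred j | c j == b]|))%N.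
Proof.
pose m (t : 'S_N) := #|[pred j | c (t j) != d j]|.
case: (@arg_minnP _ (1%g : 'S_N) xpredT m isT) => t _ tmin; exists t.
have -> : #|[pred j | c (t j) != d j]| =
    (\sum_b #|[pred j | (c (t j) != d j) && (d j == b)]|)%N.
  rewrite -sum1_card (partition_big d xpredT) //=.
  by apply: eq_bigr => b _; rewrite -sum1_card; apply: eq_bigl => j; rewrite !inE.
apply: leq_sum => b _.
have [->//|/card_gt0P[j0]] := posnP #|[pred j | (c (t j) != d j) && (d j == b)]|.
rewrite !inE => /andP[cj0 /eqP dj0].
(* Otherwise swapping [j0] with a bad [j] would remove a mismatch. *)
have sub j : c (t j) == b -> d j == b.
  move=> /eqP ctj; apply: contraT => dj; exfalso.
  have := tmin (tperm j0 j * t)%g isT; rewrite /m leqNgt => /negP; apply.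
  apply: proper_card; apply/properP; split.
    apply/fintype.subsetP => k; rewrite !inE permM; case: tpermP => [->|->|//].
      by rewrite ctj dj0 eqxx.
    by move=> _; rewrite ctj eq_sym.
  by exists j0; rewrite !inE ?permM ?tpermL ?ctj ?dj0 ?eqxx //; rewrite -dj0.
have -> : #|[pred j | c j == b]| = #|[pred j | c (t j) == b]|.
  rewrite -[LHS](card_perm_pred t^-1%g (fun j => c j == b)).
  by apply: eq_card => j; rewrite !inE invgK.
rewrite leq_subRL; last by apply/subset_leq_card/fintype.subsetP => j; rewrite !inE; exact: sub.
rewrite -cardUI; rewrite -[leqRHS]addn0; apply: leq_add.
  apply/subset_leq_card/fintype.subsetP => j; rewrite !inE => /orP[/sub//|/andP[]//].
rewrite leqn0; apply/eqP/eq_card0 => j; rewrite !inE.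
apply/negbTE/negP => /andP[/eqP ->] /andP[] /negP + /eqP dj; apply.
by rewrite dj.
Qed.

(** * Typical configurations *)

(** From $e^{-x} \ge 1-x$ one has $e^x \le 1/(1-x)$, and $(1+x+2x^2)(1-x) = 1 + x^2(1-2x)$. *)
Lemma expR_le_quad (R : realType) (x : R) :
  x <= 1 / 2 -> expR x <= 1 + x + 2 * x ^+ 2.
Proof.
move=> x2; have x1 : 0 < 1 - x by lra.
rewrite -(ler_pM2r x1); apply: (@le_trans _ _ 1).
  have := expR_ge1Dx (- x); rewrite expRN => H.
  by rewrite -[leRHS](mulfV (lt0r_neq0 (expR_gt0 x))) ler_pM2l ?expR_gt0.
have : 0 <= x ^+ 2 * (1 - 2 * x) by rewrite mulr_ge0 ?sqr_ge0 //; lra.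
by move=> H; rewrite -subr_ge0; apply: le_trans H _; rewrite le_eqVlt; apply/orP; left; apply/eqP; ring.
Qed.

Section Typical.
Variables (R : realType) (n N K : nat) (q : 'I_n -> 'I_K -> R).
Local Notation word := {ffun 'I_n -> 'I_K}.
Local Notation conf := {ffun 'I_N -> word}.
Implicit Types (c d : conf) (f w y : word -> R).

(** Only the frequencies of each coordinate are constrained, not those of whole words: these are
    what [shuffle] preserves. *)
Definition typical (e : R) d :=
  [forall i, forall b, `|(occ d i b)%:R - N%:R * q i b| <= e * N%:R].

Lemma typicalP e d : reflect
  (forall i b, `|(occ d i b)%:R - N%:R * q i b| <= e * N%:R) (typical e d).
Proof.
by apply: (iffP forallP) => [H i b|H i]; [move/forallP: (H i); exact|apply/forallP].
Qed.

Lemma typical_shuffle e s d : typical e (shuffle s d) = typical e d.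
Proof.
by apply: eq_forallb => i; apply: eq_forallb => b; rewrite occ_shuffle.
Qed.

Lemma sum_prod_conf w :
  \sum_(d : conf) \prod_j w (d j) = (\sum_a w a) ^+ N.
Proof. by rewrite -(bigA_distr_bigA (fun=> w)) prodr_const card_ord. Qed.

(** Exponential Markov inequality with parameter $s = e/4$, the minimiser of $2s^2 - se$, whose
    minimum is $-e^2/8$. The bound [e <= 2] keeps [s * y] below 1/2, as [expR_le_quad] requires. *)
Lemma chernoff w y (e : R) : (forall a, 0 <= w a) -> \sum_a w a = 1 ->
  (forall a, `|y a| <= 1) -> \sum_a w a * y a = 0 -> 0 <= e <= 2 ->
  \sum_(d : conf | e * N%:R <= \sum_j y (d j)) \prod_j w (d j) <=
  expR (- (e ^+ 2 / 8)) ^+ N.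
Proof.
move=> w0 w1 y1 wy /andP[e0 e2]; set s := e / 4.
apply: (@le_trans _ _ (\sum_(d : conf) \prod_j (w (d j) * expR (s * (y (d j) - e))))).
  rewrite big_mkcond; apply: ler_sum => d _; case: ifP => [Hd|_]; last first.
    by rewrite prodr_ge0 // => j _; rewrite mulr_ge0 ?expR_ge0.
  rewrite big_split /= ler_peMr ?prodr_ge0 // -expR_sum -expR0 ler_expR.
  rewrite -mulr_sumr mulr_ge0 ?divr_ge0 // sumrB sumr_const card_ord -mulr_natr.
  by rewrite subr_ge0.
rewrite (sum_prod_conf (fun a => w a * expR (s * (y a - e)))).
apply: lerXn2r; rewrite ?nnegrE ?expR_ge0 ?sumr_ge0 //.
  by move=> a _; rewrite mulr_ge0 ?expR_ge0.
apply: (@le_trans _ _ (\sum_a (w a * (1 + 2 * s ^+ 2) + s * (w a * y a)) * expR (- (s * e)))).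
  apply: ler_sum => a _; rewrite mulrBr expRD mulrA.
  apply: ler_wpM2r; first exact: expR_ge0.
  rewrite [s * (w a * _)]mulrCA -mulrDr; apply: ler_wpM2l => //.
  have := y1 a; rewrite ler_norml => /andP[ya yb].
  have sy : s * y a <= 1 / 2 by rewrite /s; nra.
  apply: le_trans (expR_le_quad sy) _.
  have : (s * y a) ^+ 2 <= s ^+ 2.
    rewrite exprMn ler_piMr ?sqr_ge0 // -(expr1n _ 2) -real_normK ?num_real //.
    by apply: lerXn2r; rewrite ?nnegrE.
  lra.
rewrite -mulr_suml big_split /= -mulr_suml w1 -mulr_sumr wy mulr0 addr0 mul1r.
have := expR_ge1Dx (2 * s ^+ 2) => H.
apply: le_trans (ler_wpM2r (expR_ge0 _) H) _.
by rewrite -expRD ler_expR le_eqVlt /s; apply/orP; left; apply/eqP; field.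
Qed.

Lemma typical_mass w (e : R) : (forall a, 0 <= w a) -> \sum_a w a = 1 ->
  (forall i b, \sum_(a : word | a i == b) w a = q i b) -> 0 <= e <= 2 ->
  1 - (n * K * 2)%:R * expR (- (e ^+ 2 / 8)) ^+ N <=
  \sum_(d : conf | typical e d) \prod_j w (d j).
Proof.
move=> w0 w1 wq e02.
have : \sum_(d : conf) \prod_j w (d j) = 1 by rewrite sum_prod_conf w1 expr1n.
rewrite (bigID (typical e)) /= => W; rewrite lerBlDr -[leLHS]W lerD2l.
(* The Boolean is the sign of the centred indicator: a two-sided deviation is a union of two
   one-sided events, whence [n * K * 2] events in the union bound. *)
pose y (x : 'I_n * 'I_K * bool) (a : word) : R :=
  (-1) ^+ x.2 * ((a x.1.1 == x.1.2)%:R - q x.1.1 x.1.2).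
have q01 i b : 0 <= q i b <= 1.
  rewrite -wq sumr_ge0 //= -[leRHS]w1.
  by rewrite [leRHS](bigID (fun a : word => a i == b)) /= lerDl sumr_ge0.
have -> : (n * K * 2)%:R * expR (- (e ^+ 2 / 8)) ^+ N =
    \sum_(x : 'I_n * 'I_K * bool) expR (- (e ^+ 2 / 8)) ^+ N.
  by rewrite sumr_const !card_prod !card_ord card_bool mulr_natl.
apply: (@le_trans _ _ (\sum_(x : 'I_n * 'I_K * bool)
   \sum_(d : conf | e * N%:R <= \sum_j y x (d j)) \prod_j w (d j))); last first.
  apply: ler_sum => x _; apply: chernoff => //.
    move=> a; rewrite /y normrM normrX normrN1 expr1n mul1r.
    have /andP[q0 q1] := q01 x.1.1 x.1.2.
    by case: eqP => _ /=; rewrite ?subr0 ler_norml; apply/andP; split; lra.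
  transitivity ((-1) ^+ x.2 * ((\sum_(a : word) w a * (a x.1.1 == x.1.2)%:R) - (\sum_a w a) * q x.1.1 x.1.2)).
    rewrite mulr_suml -sumrB mulr_sumr; apply: eq_bigr => a _.
    by rewrite /y; ring.
  rewrite w1 mul1r -wq [X in _ - X]big_mkcond /=.
  rewrite (eq_bigr (fun a : word => if a x.1.1 == x.1.2 then w a else 0)).
    by rewrite subrr mulr0.
  by move=> a _; case: eqP => _; rewrite ?mulr1 ?mulr0.
rewrite (exchange_big_dep xpredT) //= big_mkcond /=; apply: ler_sum => d _.
case: ifP => [|_]; last by apply: sumr_ge0 => x _; apply: prodr_ge0.
rewrite -negb_forall /=.
move=> /forallPn[i /forallPn[b]]; rewrite -ltNge => Hb.
have sy (z : bool) : \sum_j y (i, b, z) (d j) = (-1) ^+ z * ((occ d i b)%:R - N%:R * q i b).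
  rewrite /y -mulr_sumr /= sumrB sumr_const card_ord mulr_natl; congr (_ * (_ - _)).
  rewrite /occ -sum1_card natr_sum [RHS]big_mkcond /=; apply: eq_bigr => j _.
  by rewrite inE; case: ifP.
pose z := (occ d i b)%:R - N%:R * q i b < 0.
have Hz : e * N%:R <= \sum_j y (i, b, z) (d j).
  rewrite sy; apply/ltW/(lt_le_trans Hb); rewrite /z.
  case: (ltP ((occ d i b)%:R - N%:R * q i b) 0) => H /=.
    by rewrite expr1 mulN1r ltr0_norm.
  by rewrite expr0 mul1r ger0_norm.
by rewrite (bigD1 (i, b, z)) //= lerDl sumr_ge0 // => x _; apply: prodr_ge0.
Qed.

(** In each coordinate the letter counts of [c] and [d] differ by at most [2 * e * N], so shuffling
    [c], which leaves [avgexp] unchanged, brings it within [K * 2 * e * N] mismatches of [d].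
    Summing over [n] coordinates at cost [2 * M] each gives the exponent. *)
Lemma avgexp_typical f (M e : R) c d : 0 <= M -> (forall a, `|f a| <= M) ->
  typical e c -> typical e d ->
  avgexp f c <= expR (4 * M * n%:R * K%:R * e * N%:R) * avgexp f d.
Proof.
move=> M0 fM /typicalP Tc /typicalP Td.
have [t Ht] : exists t : {ffun 'I_n -> 'S_N}, forall i,
    (#|[pred j | c ((t i) j) i != d j i]| <= \sum_b (occ d i b - occ c i b))%N.
  have [t Ht] := choice (fun i => min_mismatch_perm (c^~ i) (d^~ i)).
  by exists (finfun t) => i; rewrite ffunE; exact: Ht.
(* [shuffle] reads inverse permutations, so the inverse of [t] makes it rearrange [c] by [t]
   itself. *)
pose s : {ffun 'I_n -> 'S_N} := [ffun i => (t i)^-1%g].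
rewrite -(avgexp_shuffle f s c) /avgexp mulrCA ler_pM2l; last first.
  by rewrite invr_gt0 exprn_gt0 // ltr0n fact_gt0.
rewrite mulr_sumr; apply: ler_sum => u _; rewrite -expRD ler_expR.
apply: le_trans (energy_mism _ (shuffle u d) fM) _; rewrite [leRHS]addrC lerD2l.
have mE i : (mism (shuffle u (shuffle s c)) (shuffle u d) i)%:R <= K%:R * (2 * e * N%:R) :> R.
  rewrite mism_shuffle; apply: (@le_trans _ _ (\sum_b (occ d i b - occ c i b))%:R).
    rewrite ler_nat; apply: leq_trans (Ht i).
    by apply: subset_leq_card; apply/fintype.subsetP => j; rewrite !inE !ffunE invgK.
  rewrite natr_sum mulr_natl -[K in _ *+ K]card_ord -sumr_const; apply: ler_sum => b _.
  have := Tc i b; have := Td i b; rewrite !ler_norml => /andP[? ?] /andP[? ?].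
  have [le|lt] := leqP (occ c i b) (occ d i b); first by rewrite natrB //; lra.
  by rewrite (eqP (ltnW lt)) /=; lra.
apply: (@le_trans _ _ (2 * M * (n%:R * (K%:R * (2 * e * N%:R))))).
  apply: ler_wpM2l; first by rewrite mulr_ge0.
  by rewrite mulr_natl -[n in _ *+ n]card_ord -sumr_const; apply: ler_sum.
by rewrite le_eqVlt; apply/orP; left; apply/eqP; ring.
Qed.

(** Minus the sum of the Shannon entropies of the [q i]; [qlogs] measures how fast a log-likelihood
    moves with the letter frequencies. *)
Definition qent : R := \sum_i \sum_b q i b * ln (q i b).
Definition qlogs : R := \sum_i \sum_b `|ln (q i b)|.

Lemma sum_ln_typical e d : typical e d ->
  `|\sum_j \sum_i ln (q i (d j i)) - N%:R * qent| <= N%:R * (e * qlogs).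
Proof.
move=> /typicalP T.
have -> : \sum_j \sum_i ln (q i (d j i)) =
    \sum_i \sum_b (occ d i b)%:R * ln (q i b).
  rewrite exchange_big; apply: eq_bigr => i _.
  rewrite (partition_big (fun j => d j i) xpredT) //=; apply: eq_bigr => b _.
  rewrite (eq_bigr (fun=> ln (q i b))); last by move=> j /eqP ->.
  by rewrite sumr_const mulr_natl.
rewrite /qent /qlogs !mulr_sumr -sumrB; apply: le_trans (ler_norm_sum _ _ _) _.
apply: ler_sum => i _; rewrite !mulr_sumr -sumrB; apply: le_trans (ler_norm_sum _ _ _) _.
apply: ler_sum => b _; rewrite mulrA -mulrBl normrM mulrA [_ * e]mulrC.
by apply: ler_wpM2r.
Qed.

Lemma prod_typical_le e d : (forall i b, 0 <= q i b) -> typical e d ->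
  \prod_j \prod_i q i (d j i) <= expR (N%:R * (qent + e * qlogs)).
Proof.
move=> q0 T; apply: (@le_trans _ _ (\prod_j \prod_i expR (ln (q i (d j i))))).
  apply: ler_prod => j _; rewrite prodr_ge0 //=; apply: ler_prod => i _.
  (* A letter of probability 0 gives the factor 0 on the left and a positive one on the right. *)
  rewrite q0 /=; have [->|qn] := eqVneq (q i (d j i)) 0; first exact: expR_ge0.
  by rewrite lnK // posrE lt_def qn q0.
under eq_bigr do rewrite -expR_sum.
rewrite -expR_sum ler_expR mulrDr.
by have := sum_ln_typical T; rewrite ler_norml => /andP[_]; rewrite lerBlDl.
Qed.

Lemma prod_typical_ge e d : (forall i b, 0 < q i b) -> typical e d ->
  expR (N%:R * (qent - e * qlogs)) <= \prod_j \prod_i q i (d j i).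
Proof.
move=> q0 T.
rewrite (eq_bigr (fun j => expR (\sum_i ln (q i (d j i))))); last first.
  by move=> j _; rewrite expR_sum; apply: eq_bigr => i _; rewrite lnK ?posrE.
rewrite -expR_sum ler_expR mulrBr.
by have := sum_ln_typical T; rewrite ler_norml => /andP[+ _]; lra.
Qed.

Definition qprod (a : word) : R := \prod_i q i (a i).

Lemma sum_qprod : (forall i, \sum_b q i b = 1) -> \sum_a qprod a = 1.
Proof. by move=> q1; rewrite -(bigA_distr_bigA q) big1. Qed.

Lemma marg_qprod i0 b : (forall i, \sum_b q i b = 1) ->
  \sum_(a : word | a i0 == b) qprod a = q i0 b.
Proof.
move=> q1.
pose g i b' : R := q i b' * (if i == i0 then (b' == b)%:R else 1).
transitivity (\sum_(a : word) \prod_i g i (a i)).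
  rewrite big_mkcond; apply: eq_bigr => a _; rewrite /g big_split /=.
  have -> : \prod_i (if i == i0 then (a i == b)%:R else 1) = (a i0 == b)%:R :> R.
    by rewrite (bigD1 i0) //= eqxx big1 ?mulr1 // => i /negbTE ->.
  by case: eqP => _; rewrite ?mulr1 ?mulr0.
rewrite -(bigA_distr_bigA g) (bigD1 i0) //= [X in _ * X]big1 => [|i /negbTE ni]; last first.
  by rewrite /g ni; under eq_bigr do rewrite mulr1; rewrite q1.
rewrite mulr1 /g eqxx (bigD1 b) //= eqxx mulr1 big1 ?addr0 // => c /negbTE ->.
by rewrite mulr0.
Qed.

(** Under the product law [qprod] the typical set has mass at least 1/2, while no typical
    configuration weighs more than the exponential. *)
Lemma typical_card_ge e : (forall i b, 0 <= q i b) ->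
  (forall i, \sum_b q i b = 1) -> 0 <= e <= 2 ->
  (n * K * 2)%:R * expR (- (e ^+ 2 / 8)) ^+ N <= 1 / 2 ->
  1 / 2 <= #|[pred d : conf | typical e d]|%:R * expR (N%:R * (qent + e * qlogs)).
Proof.
move=> q0 q1 e02 small.
have qp0 a : 0 <= qprod a by apply: prodr_ge0.
have := typical_mass qp0 (sum_qprod q1) (fun i b => marg_qprod i b q1) e02.
set S := (X in _ <= X -> _) => S12.
apply: (@le_trans _ _ S); first lra.
rewrite mulr_natl -sumr_const; apply: ler_sum => d Td.
exact: prod_typical_le.
Qed.

(** The total mass of the product law is 1 and each typical configuration weighs at least the
    exponential. A letter of probability 0 would make such a weight vanish, hence the positivity. *)
Lemma typical_card_le e : (forall i b, 0 < q i b) ->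
  (forall i, \sum_b q i b = 1) ->
  #|[pred d : conf | typical e d]|%:R * expR (N%:R * (qent - e * qlogs)) <= 1.
Proof.
move=> q0 q1; have q0' i b : 0 <= q i b by exact: ltW.
have W : \sum_(d : conf) \prod_j qprod (d j) = 1.
  by rewrite sum_prod_conf sum_qprod // expr1n.
rewrite -[leRHS]W [leRHS](bigID (typical e)) /= -[leLHS]addr0; apply: lerD.
  by rewrite mulr_natl -sumr_const; apply: ler_sum => d Td; exact: prod_typical_ge.
by apply: sumr_ge0 => d _; apply: prodr_ge0 => j _; apply: prodr_ge0.
Qed.

Lemma expR_energy f d : expR (energy f d) = \prod_j expR (f (d j)).
Proof. by rewrite /energy expR_sum. Qed.

Lemma avgexp_ge0 f d : 0 <= avgexp f d.
Proof.
rewrite mulr_ge0 ?invr_ge0 ?exprn_ge0 //.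
by apply: sumr_ge0 => s _; exact: expR_ge0.
Qed.

(* Averaging over permutations is unchanged, up to [e^(o(N))], when the frequencies
   change by [o(1)]; so [avgexp f c] is comparable with its mean over typical
   configurations, which is [#|typical|^-1] times a sum without permutations. *)
Lemma avgexp_upper f M e c : 0 <= M -> (forall a, `|f a| <= M) ->
  (forall i b, 0 <= q i b) -> (forall i, \sum_b q i b = 1) -> 0 <= e <= 2 ->
  (n * K * 2)%:R * expR (- (e ^+ 2 / 8)) ^+ N <= 1 / 2 -> typical e c ->
  avgexp f c <= 2 * expR (N%:R * (qent + e * (qlogs + 4 * M * n%:R * K%:R))) *
    (\sum_a expR (f a)) ^+ N.
Proof.
move=> M0 fM q0 q1 e02 small Tc.
set X := expR (4 * M * n%:R * K%:R * e * N%:R).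
set Y := expR (N%:R * (qent + e * qlogs)).
have -> : expR (N%:R * (qent + e * (qlogs + 4 * M * n%:R * K%:R))) = X * Y.
  by rewrite -expRD; congr expR; ring.
set D := #|[pred d : conf | typical e d]|%:R : R.
have DA : D * avgexp f c <= X * (\sum_a expR (f a)) ^+ N.
  rewrite /D mulr_natl -sumr_const.
  apply: (@le_trans _ _ (\sum_(d : conf | typical e d) X * avgexp f d)).
    by apply: ler_sum => d Td; exact: avgexp_typical.
  rewrite -mulr_sumr; apply: ler_wpM2l; first exact: expR_ge0.
  rewrite sum_avgexp; last by move=> s d; exact: typical_shuffle.
  under eq_bigr do rewrite expR_energy.
  rewrite -(sum_prod_conf (fun a => expR (f a))) [leRHS](bigID (typical e)) /= lerDl.
  by apply: sumr_ge0 => d _; apply: prodr_ge0 => j _; exact: expR_ge0.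
have D2 := typical_card_ge q0 q1 e02 small.
rewrite -/D -/Y in D2.
have A0 := avgexp_ge0 f c.
have := ler_wpM2r A0 D2; rewrite [D * Y * _]mulrAC => H1.
have := ler_wpM2r (expR_ge0 _ : 0 <= Y) DA => H2.
have := le_trans H1 H2; rewrite [X * _ * Y]mulrAC -[2 * _ * _]mulrA; lra.
Qed.

(** Two laws with the same marginals [q] are used: the normalised weights [w], in general not a
    product, show that typical configurations carry half of the full sum, and [qprod] bounds their
    number. *)
Lemma avgexp_lower f M e c : 0 <= M -> (forall a, `|f a| <= M) ->
  (forall i b, 0 < q i b) -> (forall i, \sum_b q i b = 1) -> 0 <= e <= 2 ->
  0 < \sum_a expR (f a) ->
  (forall i b, \sum_(a : word | a i == b) expR (f a) = q i b * \sum_a expR (f a)) ->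
  (n * K * 2)%:R * expR (- (e ^+ 2 / 8)) ^+ N <= 1 / 2 -> typical e c ->
  expR (N%:R * (qent - e * (qlogs + 4 * M * n%:R * K%:R))) *
    (\sum_a expR (f a)) ^+ N <= 2 * avgexp f c.
Proof.
move=> M0 fM q0 q1 e02 Z0 fq small Tc; set Z := \sum_a expR (f a) in Z0 fq *.
set X := expR (4 * M * n%:R * K%:R * e * N%:R).
set Y := expR (N%:R * (qent - e * qlogs)).
have XY : expR (N%:R * (qent - e * (qlogs + 4 * M * n%:R * K%:R))) * X = Y.
  by rewrite -expRD; congr expR; ring.
set D := #|[pred d : conf | typical e d]|%:R : R.
have DY : D * Y <= 1 by exact: typical_card_le.
pose w a := expR (f a) / Z.
have w0 a : 0 <= w a by rewrite divr_ge0 ?expR_ge0 // ltW.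
have w1 : \sum_a w a = 1 by rewrite -mulr_suml mulfV // gt_eqF.
have wq i b : \sum_(a : word | a i == b) w a = q i b.
  by rewrite -mulr_suml fq mulfK // gt_eqF.
have := typical_mass w0 w1 wq e02; set S := (X in _ <= X -> _) => S12.
have ZS : Z ^+ N * S <= D * (X * avgexp f c).
  have -> : Z ^+ N * S = \sum_(d : conf | typical e d) avgexp f d.
    rewrite sum_avgexp; last by move=> s d; exact: typical_shuffle.
    rewrite /S mulr_sumr; apply: eq_bigr => d _.
    rewrite expR_energy big_split /= prodr_const card_ord mulrCA -exprMn mulfV ?gt_eqF //.
    by rewrite expr1n mulr1.
  by rewrite /D mulr_natl -sumr_const; apply: ler_sum => d Td; exact: avgexp_typical.
have X0 : 0 < X by exact: expR_gt0.
have A0 := avgexp_ge0 f c.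
rewrite -(ler_pM2r X0) mulrAC XY.
have ZN : 0 <= Z ^+ N by rewrite exprn_ge0 // ltW.
have Y0 : 0 <= Y by exact: expR_ge0.
have H1 : Y * (Z ^+ N * S) <= X * avgexp f c.
  apply: le_trans (ler_wpM2l Y0 ZS) _; rewrite [Y * (D * _)]mulrA [Y * D]mulrC.
  by rewrite -[leRHS]mul1r ler_wpM2r // mulr_ge0 // ltW.
have H2 : Y * (Z ^+ N * (1 / 2)) <= Y * (Z ^+ N * S).
  by apply: ler_wpM2l => //; apply: ler_wpM2l => //; lra.
have := le_trans H2 H1; rewrite mulrA => H; lra.
Qed.

End Typical.

(** * Exponential growth rates of permutation averages *)

Lemma geometric_eventually_le (R : realType) (C x e : R) : 0 <= x < 1 -> 0 < e ->
  exists N0, forall N, (N0 <= N)%N -> C * x ^+ N <= e.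
Proof.
move=> /andP[x0 x1] e0.
have : (fun N => C * x ^+ N) @ \oo --> C * 0.
  by apply: cvgMr; apply: cvg_expr; rewrite ger0_norm.
rewrite mulr0 => /cvgrPdist_le /(_ e e0)[N0 _ H]; exists N0 => N /H /=.
by rewrite sub0r normrN; apply: le_trans; exact: ler_norm.
Qed.

Section Asymptotics.
Variables (R : realType) (n K : nat) (q : 'I_n -> 'I_K -> R).
Variable f : {ffun 'I_n -> 'I_K} -> R.
Hypothesis q1 : forall i, \sum_b q i b = 1.
Hypothesis Z0 : 0 < \sum_a expR (f a).

Let M := \sum_a `|f a|.
Let M0 : 0 <= M. Proof. exact: sumr_ge0. Qed.
Let fM a : `|f a| <= M.
Proof. by rewrite /M (bigD1 a) //= lerDl sumr_ge0. Qed.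

(** The tolerance [e] is fixed before [N]. It makes the linear error at most [eps / 2]; a large [N]
    then brings the union bound below 1/2 and lets the exponential absorb the constant 2. *)
Lemma small_params eps : 0 < eps -> exists2 e, 0 < e & exists N0, forall N, (N0 <= N)%N ->
  [/\ 0 <= e <= 2, (n * K * 2)%:R * expR (- (e ^+ 2 / 8)) ^+ N <= 1 / 2 :> R,
     e * (qlogs q + 4 * M * n%:R * K%:R) <= eps / 2 & 2 <= expR (N%:R * (eps / 2))].
Proof.
move=> eps0; set L := qlogs q + 4 * M * n%:R * K%:R.
have L0 : 0 <= L.
  rewrite addr_ge0 ?mulr_ge0 //.
  by apply: sumr_ge0 => i _; apply: sumr_ge0.
have L1 : 0 < 2 * (L + 1) by lra.
(* The cap 2 is the range of [chernoff]; the [+ 1] avoids dividing by 0 when [L] vanishes. *)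
pose e := Num.min 2 (eps / (2 * (L + 1))).
have e0 : 0 < e by rewrite lt_min divr_gt0 //; lra.
have e2 : e <= 2 by rewrite ge_min lexx.
have eL : e * L <= eps / 2.
  apply: (@le_trans _ _ (eps / (2 * (L + 1)) * L)).
    by rewrite ler_wpM2r // ge_min lexx orbT.
  rewrite mulrAC ler_pdivrMr //; nra.
have x1 : 0 <= expR (- (e ^+ 2 / 8)) < 1.
  by rewrite expR_ge0 expR_lt1 oppr_lt0 divr_gt0 // exprn_gt0.
have [N1 H1] := geometric_eventually_le (n * K * 2)%:R x1 (divr_gt0 ltr01 (ltr0Sn _ 1)).
exists e => //; exists (maxn N1 (Num.Def.trunc (2 / eps)).+1) => N.
rewrite geq_max => /andP[HN1 HN2]; split => //.
- by rewrite ltW.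
- exact: H1.
apply: le_trans (expR_ge1Dx _).
have : 2 / eps <= N%:R.
  by apply/ltW/(lt_le_trans (truncnS_gt _)); rewrite ler_nat.
by rewrite ler_pdivrMr //; lra.
Qed.

Lemma avgexp_le_asymp eps : (forall i b, 0 <= q i b) -> 0 < eps ->
  exists2 e, 0 < e & exists N0, forall N, (N0 <= N)%N ->
    forall c : {ffun 'I_N -> _}, typical q e c ->
    avgexp f c <= expR (N%:R * (qent q + ln (\sum_a expR (f a)) + eps)).
Proof.
move=> q0 eps0; have [e e0 [N0 H]] := small_params eps0.
exists e => //; exists N0 => N /H[e02 small eL two] c Tc.
apply: le_trans (avgexp_upper M0 fM q0 q1 e02 small Tc) _.
rewrite -[X in _ * X ^+ N]lnK ?posrE // -expRM_natl.
apply: (@le_trans _ _ (expR (N%:R * (eps / 2)) * expR (N%:R * (qent q + eps / 2)) *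
   expR (N%:R * ln (\sum_a expR (f a))))).
  apply: ler_wpM2r; first exact: expR_ge0.
  apply: ler_pM; rewrite ?expR_ge0 // ler_expR ler_wpM2l //; lra.
by rewrite -!expRD ler_expR le_eqVlt; apply/orP; left; apply/eqP; field.
Qed.

Lemma avgexp_ge_asymp eps : (forall i b, 0 < q i b) ->
  (forall i b, \sum_(a : {ffun 'I_n -> 'I_K} | a i == b) expR (f a) =
     q i b * \sum_a expR (f a)) -> 0 < eps ->
  exists2 e, 0 < e & exists N0, forall N, (N0 <= N)%N ->
    forall c : {ffun 'I_N -> _}, typical q e c ->
    expR (N%:R * (qent q + ln (\sum_a expR (f a)) - eps)) <= avgexp f c.
Proof.
move=> q0 fq eps0; have [e e0 [N0 H]] := small_params eps0.
exists e => //; exists N0 => N /H[e02 small eL two] c Tc.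
have := avgexp_lower M0 fM q0 q1 e02 Z0 fq small Tc.
rewrite -[X in _ * X ^+ N]lnK ?posrE // -expRM_natl => A2.
have : 2 * avgexp f c <= expR (N%:R * (eps / 2)) * avgexp f c.
  by rewrite ler_wpM2r // avgexp_ge0.
move/(le_trans A2); rewrite [leRHS]mulrC -ler_pdivrMr ?expR_gt0 // -expRN -!expRD.
apply: le_trans; rewrite ler_expR.
have : N%:R * (e * (qlogs q + 4 * M * n%:R * K%:R)) <= N%:R * (eps / 2).
  by rewrite ler_wpM2l.
lra.
Qed.

End Asymptotics.

(** * Integrals over an interval and its cells *)

Section OneDim.
Variables (R : realType) (r : R).
Local Notation lam := (@lam R).
Local Notation mR := (measurableTypeR R).
Implicit Types (A B : set mR) (phi psi : R -> R).

(** Uniform continuity is asked on the whole line; clamping will supply integrands of this kind. *)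
Definition ucont phi := forall e, 0 < e -> exists2 d, 0 < d &
  forall x y, `|x - y| <= d -> `|phi x - phi y| <= e.

Definition intg phi := lam.-integrable (Ir r) (EFin \o phi).

Definition int1 A phi : R := \int[lam]_(x in A `&` Ir r) phi x.

Definition mass A : R := fine (lam (A `&` Ir r)).

Lemma measurable_Ir : measurable (Ir r : set mR).
Proof. exact: measurable_itv. Qed.

Lemma measurable_capIr A : measurable A -> measurable (A `&` Ir r).
Proof. by move=> mA; apply: measurableI => //; exact: measurable_Ir. Qed.

Lemma lam_Ir : 0 < r -> lam (Ir r) = (2 * r)%:E.
Proof.
move=> r0; rewrite /lam /Ir lebesgue_measure_itv /= lte_fin ifT; last lra.
by rewrite -EFinB; congr EFin; lra.
Qed.

Lemma lam_capIr_fin A : measurable A -> (lam (A `&` Ir r) < +oo)%E.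
Proof.
move=> mA; apply: (@le_lt_trans _ _ (lam (Ir r))).
  by apply: le_measure; rewrite ?inE //; [exact: measurable_capIr|exact: measurable_Ir].
rewrite /lam /Ir lebesgue_measure_itv /=; case: ifP => _ //.
by rewrite -EFinB ltry.
Qed.

Lemma massE A : measurable A -> (mass A)%:E = lam (A `&` Ir r).
Proof.
by move=> mA; rewrite fineK // ge0_fin_numE ?measure_ge0 //; exact: lam_capIr_fin.
Qed.

Lemma mass_le A : 0 < r -> measurable A -> mass A <= 2 * r.
Proof.
move=> r0 mA; rewrite -lee_fin massE // -lam_Ir //.
by apply: le_measure; rewrite ?inE //; [exact: measurable_capIr|exact: measurable_Ir].
Qed.

Lemma mass_setT : 0 < r -> mass setT = 2 * r.
Proof. by move=> r0; rewrite /mass setTI lam_Ir. Qed.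

Lemma ucont_continuous phi : ucont phi -> continuous phi.
Proof.
move=> uc x; apply/cvgrPdist_le => e /uc[d d0 H].
near=> y; apply: H; near: y.
exact: (@cvgr_dist_le _ _ _ (nbhs x) _ id x cvg_id).
Unshelve. all: by end_near. Qed.

Lemma continuous_intg phi : continuous phi -> intg phi.
Proof.
move=> cphi; apply: continuous_compact_integrable; first exact: segment_compact.
exact: continuous_subspaceT.
Qed.

Lemma ucont_intg phi : ucont phi -> intg phi.
Proof. by move=> /ucont_continuous; exact: continuous_intg. Qed.

Lemma intg_capIr A phi : measurable A -> intg phi ->
  lam.-integrable (A `&` Ir r) (EFin \o phi).
Proof.
by move=> mA; apply: integrableS; [exact: measurable_Ir|exact: measurable_capIr|].
Qed.

Lemma int1E A phi : measurable A -> intg phi ->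
  (\int[lam]_(x in A `&` Ir r) (phi x)%:E)%E = (int1 A phi)%:E.
Proof.
move=> mA ip; rewrite /int1 /Rintegral fineK //.
by apply: integrable_fin_num; [exact: measurable_capIr|exact: intg_capIr].
Qed.

Lemma intgD phi psi : intg phi -> intg psi -> intg (fun x => phi x + psi x).
Proof.
by move=> i1 i2; have := integrableD measurable_Ir i1 i2.
Qed.

Lemma intgZ c phi : intg phi -> intg (fun x => c * phi x).
Proof.
by move=> i1; have := integrableZl measurable_Ir c i1.
Qed.

Lemma int1D A phi psi : measurable A -> intg phi -> intg psi ->
  int1 A (fun x => phi x + psi x) = int1 A phi + int1 A psi.
Proof.
by move=> mA ip iq; apply: RintegralD; rewrite ?intg_capIr //; exact: measurable_capIr.
Qed.

Lemma int1Z A c phi : measurable A -> intg phi ->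
  int1 A (fun x => c * phi x) = c * int1 A phi.
Proof.
by move=> mA ip; apply: RintegralZl; rewrite ?intg_capIr //; exact: measurable_capIr.
Qed.

Lemma int1_le A phi psi : measurable A -> intg phi -> intg psi ->
  (forall x, A x -> Ir r x -> phi x <= psi x) -> int1 A phi <= int1 A psi.
Proof.
move=> mA ip iq le; apply: le_Rintegral; rewrite ?intg_capIr //.
  exact: measurable_capIr.
by move=> x [Ax Ix]; exact: le.
Qed.

Lemma eq_int1 A phi psi : (forall x, A x -> Ir r x -> phi x = psi x) ->
  int1 A phi = int1 A psi.
Proof.
by move=> e; apply: eq_Rintegral => x; rewrite inE => -[Ax Ix]; exact: e.
Qed.

Lemma intg_cst c : intg (cst c).
Proof. by apply: continuous_intg; exact: cst_continuous. Qed.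

Lemma int1_cst A c : measurable A -> int1 A (cst c) = c * mass A.
Proof.
by move=> mA; rewrite /int1 Rintegral_cst //; exact: measurable_capIr.
Qed.

Lemma intg_sum (I : Type) (s : seq I) (P : pred I) (f : I -> R -> R) :
  (forall i, intg (f i)) -> intg (fun x => \sum_(i <- s | P i) f i x).
Proof.
move=> If; elim: s => [|i s IH].
  by rewrite (_ : (fun _ => _) = cst 0); [exact: intg_cst|apply/funext => x; rewrite big_nil].
rewrite (_ : (fun _ => _) = fun x => (if P i then f i x else 0) +
    \sum_(i <- s | P i) f i x); last first.
  by apply/funext => x; rewrite big_cons; case: ifP; rewrite ?add0r.
by apply: intgD => //; case: (P i) => //; exact: intg_cst.
Qed.

Lemma int1_sum (I : Type) (s : seq I) (P : pred I) (f : I -> R -> R) A :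
  measurable A -> (forall i, intg (f i)) ->
  int1 A (fun x => \sum_(i <- s | P i) f i x) = \sum_(i <- s | P i) int1 A (f i).
Proof.
move=> mA If; elim: s => [|i s IH].
  transitivity (int1 A (cst 0)); first by apply: eq_int1 => x _ _; rewrite big_nil.
  by rewrite int1_cst // mul0r big_nil.
transitivity (int1 A (fun x => (if P i then f i x else 0) + \sum_(i <- s | P i) f i x)).
  by apply: eq_int1 => x _ _; rewrite big_cons; case: ifP; rewrite ?add0r.
rewrite int1D //; [|by case: (P i) => //; exact: intg_cst|exact: intg_sum].
rewrite big_cons IH; case: (P i) => //.
by have := int1_cst 0 mA; rewrite /cst => ->; rewrite mul0r add0r.
Qed.

Lemma int1_close A phi psi e : 0 < r -> measurable A -> intg phi -> intg psi -> 0 <= e ->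
  (forall x, Ir r x -> `|phi x - psi x| <= e) ->
  `|int1 A phi - int1 A psi| <= e * (2 * r).
Proof.
move=> r0 mA ip iq e0 H.
have le a b : intg a -> intg b -> (forall x, Ir r x -> `|a x - b x| <= e) ->
    int1 A a <= int1 A b + e * (2 * r).
  move=> ia ib ab; apply: (@le_trans _ _ (int1 A (fun x => b x + e))).
    apply: int1_le => //; first by apply: intgD => //; exact: intg_cst.
    by move=> x _ /ab; rewrite ler_distl => /andP[].
  rewrite int1D //; last exact: intg_cst.
  have := int1_cst e mA; rewrite /cst => ->.
  by rewrite lerD2l ler_wpM2l // mass_le.
by rewrite ler_distl lerBlDr !le // => x Ix; rewrite distrC H.
Qed.

Lemma int1_setU A B phi : measurable A -> measurable B -> [disjoint A & B] ->
  intg phi -> int1 (A `|` B) phi = int1 A phi + int1 B phi.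
Proof.
move=> mA mB dAB ip; rewrite /int1 setIUl Rintegral_setU //.
- exact: measurable_capIr.
- exact: measurable_capIr.
- by rewrite -setIUl; apply: intg_capIr => //; exact: measurableU.
rewrite disj_set2E; apply/eqP; rewrite setIACA setIid.
by move: dAB; rewrite disj_set2E => /eqP ->; rewrite set0I.
Qed.

End OneDim.

(** * The grid of cells and Riemann sums *)

Section Cells.
Variables (R : realType) (r : R) (K' : nat).
Hypothesis r0 : 0 < r.
Local Notation lam := (@lam R).
Local Notation mR := (measurableTypeR R).
Local Notation K := K'.+1.
Implicit Types (A B : set mR) (phi psi : R -> R).

Definition ell : R := 2 * r / K%:R.
(** [minn] sends the endpoint [r] to the last cell. Points left of $-r$ get index 0 and points right
    of [r] index [K'], so the cells partition the whole line. *)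
Definition idx (x : R) : 'I_K := inord (minn K' (Num.truncn ((x + r) / ell))).
Definition pt (k : nat) : R := - r + k%:R * ell.
Definition cell (b : 'I_K) : set mR := [set x | idx x = b].
(** For [0 < k <= K'] this is a closed half-line. Half-lines are what moments control; cells are
    differences of consecutive ones, and sums over cells telescope. *)
Definition upcells (k : nat) : set mR := [set x | (k <= idx x)%N].

Lemma ell_gt0 : 0 < ell.
Proof. by rewrite divr_gt0 // mulr_gt0. Qed.

Lemma ptK : pt K = r.
Proof. by rewrite /pt /ell mulrC mulfVK ?pnatr_eq0 //; lra. Qed.

Lemma leq_idx k x : (0 < k)%N -> (k <= K')%N -> (k <= idx x)%N = (pt k <= x).
Proof.
case: k => // k _ kK; rewrite inordK ?ltnS ?geq_minl // leq_min kK /=.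
rewrite truncn_gt_nat ler_pdivlMr ?ell_gt0 // /pt; lra.
Qed.

Lemma pt_in (b : 'I_K) : Ir r (pt b).
Proof.
rewrite /Ir /= in_itv /= /pt; have := ell_gt0 => l0; apply/andP; split.
  by rewrite lerDl mulr_ge0 // ltW.
rewrite -[leRHS]ptK /pt lerD2l ler_pM2r // ler_nat; exact/ltnW/ltn_ord.
Qed.

Lemma idx_pt (b : 'I_K) : idx (pt b) = b.
Proof.
apply: val_inj; rewrite /= inordK ?ltnS ?geq_minl //.
rewrite /pt [- r + _]addrC addrNK.
by rewrite mulfK ?gt_eqF ?ell_gt0 // natrK; apply/minn_idPr; rewrite -ltnS.
Qed.

Lemma idx_bounds x : Ir r x -> pt (idx x) <= x <= pt (idx x) + ell.
Proof.
rewrite /Ir /= in_itv /= => /andP[x1 x2]; apply/andP; split.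
  have [E|lt0] := posnP (idx x); first by rewrite E /pt mul0r addr0.
  by rewrite -leq_idx // -ltnS.
have E : pt (idx x) + ell = pt (idx x).+1 by rewrite /pt -natr1; ring.
rewrite E; have [lt|ge] := ltnP (idx x) K'.
  by rewrite leNgt; apply/negP => /ltW; rewrite -leq_idx // ltnn.
have -> : (idx x).+1 = K by apply/eqP; rewrite eqn_leq ltn_ord ltnS.
by rewrite ptK.
Qed.

Lemma idx_close x y : Ir r x -> Ir r y -> idx x = idx y -> `|x - y| <= ell.
Proof.
move=> /idx_bounds /andP[x1 x2] /idx_bounds /andP[y1 y2] E.
by rewrite E in x1 x2; rewrite ler_distl; apply/andP; split; lra.
Qed.

Lemma upcells0 : upcells 0 = setT.
Proof. by apply/seteqP; split. Qed.

Lemma upcellsK : upcells K = set0.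
Proof. by apply/seteqP; split => // x; rewrite /upcells /= leqNgt ltn_ord. Qed.

Lemma upcellsE k : (0 < k)%N -> (k <= K')%N -> upcells k = `[pt k, +oo[%classic.
Proof.
by move=> k0 kK; apply/seteqP; split => x; rewrite /upcells /= leq_idx // in_itv /= andbT.
Qed.

Lemma measurable_upcells k : measurable (upcells k).
Proof.
have [->|k0] := posnP k; first by rewrite upcells0.
have [kK|kK] := leqP k K'; first by rewrite upcellsE //; exact: measurable_itv.
rewrite (_ : upcells k = set0) //; apply/seteqP; split => // x.
by rewrite /upcells /= leqNgt (leq_trans (ltn_ord _)).
Qed.

Lemma upcellsS (b : 'I_K) : upcells b = cell b `|` upcells b.+1.
Proof.
apply/seteqP; split => x; rewrite /upcells /cell /=.
  by rewrite leq_eqVlt => /orP[/eqP/val_inj ->|]; [left|right].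
by case=> [->|/ltnW].
Qed.

Lemma cell_upcells (b : 'I_K) : [disjoint cell b & upcells b.+1].
Proof.
rewrite disj_set2E; apply/eqP/seteqP; split => // x [].
by rewrite /cell /upcells /= => ->; rewrite ltnn.
Qed.

Lemma measurable_cell b : measurable (cell b).
Proof.
rewrite (_ : cell b = upcells b `\` upcells b.+1).
  by apply: measurableD; exact: measurable_upcells.
apply/seteqP; split => x; rewrite /cell /upcells /=.
  by move=> <-; split; rewrite ?ltnn.
by move=> [l /negP]; rewrite -leqNgt => g; apply/val_inj/eqP; rewrite eqn_leq l g.
Qed.

Lemma int1_upcellsS B (b : 'I_K) phi : measurable B -> intg r phi ->
  int1 r (B `&` upcells b) phi =
  int1 r (B `&` cell b) phi + int1 r (B `&` upcells b.+1) phi.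
Proof.
move=> mB ip; rewrite upcellsS setIUr int1_setU //.
- by apply: measurableI => //; exact: measurable_cell.
- by apply: measurableI => //; exact: measurable_upcells.
rewrite disj_set2E setIACA; have := cell_upcells b; rewrite disj_set2E => /eqP ->.
by rewrite setI0.
Qed.

Lemma int1_cells B phi : measurable B -> intg r phi ->
  int1 r B phi = \sum_b int1 r (B `&` cell b) phi.
Proof.
move=> mB ip; pose u k := int1 r (B `&` upcells k) phi.
rewrite (eq_bigr (fun b : 'I_K => - (u b.+1 - u b))); last first.
  by move=> b _; rewrite /u int1_upcellsS //; ring.
rewrite -(big_mkord xpredT (fun k => - (u k.+1 - u k))) sumrN telescope_sumr // opprB.
rewrite /u upcells0 setIT upcellsK setI0 /int1 set0I Rintegral_set0 subr0.
by [].
Qed.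

Lemma massE1 A : measurable A -> mass r A = int1 r A (cst 1).
Proof. by move=> mA; rewrite int1_cst // mul1r. Qed.

Lemma mass_cells B : measurable B -> \sum_b mass r (B `&` cell b) = mass r B.
Proof.
move=> mB; rewrite massE1 // int1_cells //; last exact: intg_cst.
apply: eq_bigr => b _; rewrite massE1 //.
by apply: measurableI => //; exact: measurable_cell.
Qed.

Lemma mass_upcells k : (k <= K)%N -> mass r (upcells k) = 2 * r - k%:R * ell.
Proof.
have [->|k0] := posnP k; first by rewrite upcells0 mass_setT // mul0r subr0.
rewrite leq_eqVlt => /orP[/eqP ->|].
  rewrite upcellsK /mass set0I /lam measure0 /=; have := ptK; rewrite /pt; lra.
rewrite ltnS => kK; rewrite upcellsE // /mass /Ir.
have pk : - r < pt k by rewrite /pt ltrDl mulr_gt0 ?ell_gt0 // ltr0n.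
have pr : pt k < r by rewrite -[ltRHS]ptK /pt ltrD2l ltr_pM2r ?ell_gt0 // ltr_nat.
rewrite (_ : _ `&` _ = `[pt k, r]%classic); last first.
  apply/seteqP; split => x; rewrite /= !in_itv /= ?andbT.
    by move=> [-> /andP[_ ->]].
  by move=> /andP[a b]; rewrite a b; split => //; rewrite andbT; lra.
rewrite /lam lebesgue_measure_itv /= lte_fin pr -EFinB /= /pt; lra.
Qed.

Lemma mass_cell b : mass r (cell b) = ell.
Proof.
have mU k := measurable_upcells k; have mC := measurable_cell b.
have := int1_upcellsS b measurableT (intg_cst r 1).
rewrite !setTI -!massE1 // !mass_upcells ?(ltnW (ltn_ord b)) //.
by rewrite -natr1; lra.
Qed.

Lemma riemann_sum B phi e : measurable B -> intg r phi -> 0 <= e ->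
  (forall x, Ir r x -> `|phi x - phi (pt (idx x))| <= e) ->
  `|int1 r B phi - \sum_(b < K) phi (pt b) * mass r (B `&` cell b)| <= e * (2 * r).
Proof.
move=> mB ip e0 H.
apply: (@le_trans _ _ (e * mass r B)); last by rewrite ler_wpM2l // mass_le.
rewrite int1_cells // -(mass_cells mB) -sumrB mulr_sumr.
apply: le_trans (ler_norm_sum _ _ _) _; apply: ler_sum => b _.
have mBb : measurable (B `&` cell b) by apply: measurableI => //; exact: measurable_cell.
have near x : (B `&` cell b) x -> Ir r x -> `|phi x - phi (pt b)| <= e.
  by move=> [_ <-]; exact: H.
rewrite ler_distl -mulrBl -mulrDl -!int1_cst //; apply/andP; split.
  by apply: int1_le => //; [exact: intg_cst|move=> x Bx /(near x Bx); rewrite ler_distl => /andP[]].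
by apply: int1_le => //; [exact: intg_cst|move=> x Bx /(near x Bx); rewrite ler_distl => /andP[]].
Qed.

End Cells.

Lemma small_ell (R : realType) (r d : R) : 0 < r -> 0 < d ->
  exists K0, forall K', (K0 <= K')%N -> ell r K' <= d.
Proof.
move=> r0 d0; exists (Num.truncn (2 * r / d)) => K' HK.
rewrite /ell ler_pdivrMr ?ltr0n // [d * _]mulrC -ler_pdivrMr //.
by apply/ltW/(lt_le_trans (truncnS_gt _)); rewrite ler_nat ltnS.
Qed.

(** * Exchange of two integrations *)

Section Swap.
Variables (R : realType) (r : R).
Hypothesis r0 : 0 < r.
Local Notation mR := (measurableTypeR R).

Definition ucont2 (G : R -> R -> R) := forall e, 0 < e -> exists2 d, 0 < d &
  forall x x' y y', `|x - x'| <= d -> `|y - y'| <= d -> `|G x y - G x' y'| <= e.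

Lemma ucont2_l G y : ucont2 G -> ucont (G^~ y).
Proof.
move=> uG e /uG[d d0 H]; exists d => // x x' xx; apply: H => //.
by rewrite subrr normr0 ltW.
Qed.

Lemma ucont2_r G x : ucont2 G -> ucont (G x).
Proof.
move=> uG e /uG[d d0 H]; exists d => // y y' yy; apply: H => //.
by rewrite subrr normr0 ltW.
Qed.

Lemma ucont_int1 (B : set mR) G : measurable B -> ucont2 G ->
  ucont (fun x => int1 r B (G x)).
Proof.
move=> mB uG e e0.
have r2 : 0 < 2 * r by rewrite mulr_gt0.
have /uG[d d0 H] : 0 < e / (2 * r) by rewrite divr_gt0.
exists d => // x x' xx; rewrite -[leRHS](divfK (lt0r_neq0 r2)).
apply: int1_close => //; try exact/ucont_intg/ucont2_r.
- by rewrite divr_ge0 // ltW.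
- by move=> y _; apply: H => //; rewrite subrr normr0 ltW.
Qed.

(** Replacing [y] by the left end of its cell changes [G] by at most [e']. Both iterated integrals
    are thus within [e' * (2 * r) * (2 * r)] of the same finite sum [S], in which only one
    integration is left. *)
Lemma int1_swap (A B : set mR) G : measurable A -> measurable B -> ucont2 G ->
  int1 r A (fun x => int1 r B (G x)) = int1 r B (fun y => int1 r A (G^~ y)).
Proof.
move=> mA mB uG.
have uG' : ucont2 (fun y x => G x y).
  by move=> e /uG[d d0 H]; exists d => // x x' y y' xx yy; exact: H.
have r2 : 0 < 2 * r by rewrite mulr_gt0.
apply/eqP; rewrite -subr_eq0 -normr_le0; apply/ler_addgt0Pr => e e0; rewrite add0r.
have e1 : 0 < e / (2 * (2 * r) * (2 * r)) by rewrite divr_gt0 // !mulr_gt0.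
have [d d0 H] := uG _ e1; set e' := e / _ in e1 H.
have [K' /(_ _ (leqnn K')) lK] := small_ell r0 d0.
pose m (b : 'I_K'.+1) := mass r (B `&` cell r b).
pose S := \sum_(b < K'.+1) int1 r A (fun x => G x (pt r K' b)) * m b.
have near y : Ir r y -> forall x, `|G x y - G x (pt r K' (idx r K' y))| <= e'.
  move=> Iy x; apply: H; first by rewrite subrr normr0 ltW.
  apply: le_trans lK; apply: idx_close => //; first exact: pt_in.
  by rewrite idx_pt.
have H1 : `|int1 r A (fun x => int1 r B (G x)) - S| <= e' * (2 * r) * (2 * r).
  rewrite (_ : S = int1 r A (fun x => \sum_(b < K'.+1) m b * G x (pt r K' b))); last first.
    rewrite int1_sum // => [|b]; last by apply/intgZ/ucont_intg/ucont2_l.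
    by apply: eq_bigr => b _; rewrite int1Z // 1?mulrC //; exact/ucont_intg/ucont2_l.
  apply: int1_close => //.
  - exact/ucont_intg/ucont_int1.
  - by apply: intg_sum => b; exact/intgZ/ucont_intg/ucont2_l.
  - by rewrite mulr_ge0 // ltW.
  move=> x _; under [X in _ - X]eq_bigr do rewrite mulrC.
  apply: (riemann_sum r0 (phi := G x)) => //; last by move=> y /near.
  - exact/ucont_intg/ucont2_r.
  - exact: ltW.
have H2 : `|int1 r B (fun y => int1 r A (G^~ y)) - S| <= e' * (2 * r) * (2 * r).
  apply: (riemann_sum r0 (phi := fun y => int1 r A (G^~ y))) => //.
  - exact/ucont_intg/(ucont_int1 mA uG').
  - by rewrite mulr_ge0 // ltW.
  move=> y Iy; apply: int1_close => //; try exact/ucont_intg/ucont2_l.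
  - exact: ltW.
  - by move=> x _; exact: near.
have -> : e = e' * (2 * r) * (2 * r) + e' * (2 * r) * (2 * r).
  by rewrite /e'; field; rewrite gt_eqF.
by apply: le_trans (ler_distD S _ _) _; apply: lerD; rewrite // distrC.
Qed.

End Swap.

(** * Iterated integrals *)

Definition upd (T : Type) (s : nat -> T) (k : nat) (x : T) : nat -> T :=
  fun j => if j == k then x else s j.

Lemma upd_same (T : Type) (s : nat -> T) k x : upd s k x k = x.
Proof. by rewrite /upd eqxx. Qed.

Lemma upd_other (T : Type) (s : nat -> T) k j x : j != k -> upd s k x j = s j.
Proof. by rewrite /upd => /negbTE ->. Qed.

Lemma updC (T : Type) (s : nat -> T) k l x y : k != l ->
  upd (upd s k x) l y = upd (upd s l y) k x.
Proof.
move=> kl; apply/funext => j; rewrite /upd.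
by have [->|//] := eqVneq j l; rewrite eq_sym (negbTE kl).
Qed.

Section Iter.
Variables (R : realType) (r : R).
Hypothesis r0 : 0 < r.
Local Notation mR := (measurableTypeR R).
Implicit Types (A B : nat -> set mR) (F G : (nat -> R) -> R) (s : nat -> R).
Implicit Types (S : pred nat).

(** Continuity for the supremum distance on sequences; sequences replace row vectors because
    [iint_aux] overwrites entries of a sequence one at a time. *)
Definition uc F := forall e, 0 < e -> exists2 d, 0 < d &
  forall s s', (forall k, `|s k - s' k| <= d) -> `|F s - F s'| <= e.

(** Real-valued counterpart of [iint_aux], with a domain [A k] per variable so that boxes of cells
    can be integrated over. *)
Fixpoint itr m S A F s : R :=
  if m is m'.+1 then
    if S m' then int1 r (A m') (fun x => itr m' S A F (upd s m' x))
    else itr m' S A F s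
  else F s.

Lemma ucont2_upd F s k l : uc F -> ucont2 (fun x y => F (upd (upd s k x) l y)).
Proof.
move=> uF e /uF[d d0 H]; exists d => // x x' y y' xx yy; apply: H => j.
by rewrite /upd; case: eqP => // _; case: eqP => // _; rewrite subrr normr0 ltW.
Qed.

Lemma ucont_upd F s k : uc F -> ucont (fun x => F (upd s k x)).
Proof.
move=> uF e /uF[d d0 H]; exists d => // x x' xx; apply: H => j.
by rewrite /upd; case: eqP => // _; rewrite subrr normr0 ltW.
Qed.

Lemma intg_upd F s k : uc F -> intg r (fun x => F (upd s k x)).
Proof. by move=> uF; exact/ucont_intg/ucont_upd. Qed.

Lemma uc_int1 (B : set mR) F k : measurable B -> uc F ->
  uc (fun s => int1 r B (fun x => F (upd s k x))).
Proof.
move=> mB uF e e0; have r2 : 0 < 2 * r by rewrite mulr_gt0.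
have /uF[d d0 H] : 0 < e / (2 * r) by rewrite divr_gt0.
exists d => // s s' ss; rewrite -[leRHS](divfK (lt0r_neq0 r2)).
apply: int1_close => //; try exact: intg_upd.
- by rewrite divr_ge0 // ltW.
- by move=> x _; apply: H => j; rewrite /upd; case: eqP => // _; rewrite subrr normr0 ltW.
Qed.

Lemma itr_uc m S A F : (forall k, measurable (A k)) -> uc F -> uc (itr m S A F).
Proof.
move=> mA uF; elim: m => //= m IH.
by case: (S m) => //; exact: uc_int1.
Qed.

Lemma uc_lin F G c : uc F -> uc G -> uc (fun s => F s + c * G s).
Proof.
move=> uF uG e e0.
have /uF[d d0 H] : 0 < e / 2 by rewrite divr_gt0.
have c0 : 0 < 2 * (`|c| + 1) by rewrite mulr_gt0 // ltr_wpDl.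
have /uG[d' d'0 H'] : 0 < e / (2 * (`|c| + 1)) by rewrite divr_gt0.
exists (Num.min d d'); first by rewrite lt_min d0.
move=> s s' ss.
have h1 : `|F s - F s'| <= e / 2.
  by apply: H => k; apply: le_trans (ss k) _; rewrite ge_min lexx.
have h2 : `|G s - G s'| <= e / (2 * (`|c| + 1)).
  by apply: H' => k; apply: le_trans (ss k) _; rewrite ge_min lexx orbT.
rewrite opprD addrACA -mulrBr (le_trans (ler_normD _ _)) // normrM.
have : `|c| * `|G s - G s'| <= e / 2.
  apply: le_trans (ler_wpM2l (normr_ge0 _) h2) _.
  rewrite mulrA ler_pdivrMr // mulrA [e / 2 * 2]divfK // mulrC ler_pM2l // lerDl.
  exact: ler01.
lra.
Qed.

Lemma itr_lin m S A F G c s : (forall k, measurable (A k)) -> uc F -> uc G ->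
  itr m S A (fun s => F s + c * G s) s = itr m S A F s + c * itr m S A G s.
Proof.
move=> mA uF uG; elim: m s => //= m IH s; case: (S m) => //.
have iF H : uc H -> intg r (fun x => itr m S A H (upd s m x)).
  by move=> uH; apply: intg_upd; exact: itr_uc.
rewrite -int1Z ?iF // -int1D ?iF //; last by apply: intgZ; exact: iF.
by apply: eq_int1 => x _ _.
Qed.

Lemma itrZ m S A F c s : (forall k, measurable (A k)) -> uc F ->
  itr m S A (fun s => c * F s) s = c * itr m S A F s.
Proof.
move=> mA uF.
have -> : (fun s => c * F s) = (fun s => F s + (c - 1) * F s).
  by apply/funext => t; ring.
by rewrite itr_lin //; ring.
Qed.

Lemma eq_itr m S S' A A' F s : (forall k, measurable (A k)) -> uc F ->
  (forall k, (k < m)%N -> S k = S' k) ->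
  (forall k phi, (k < m)%N -> S k -> ucont phi -> int1 r (A k) phi = int1 r (A' k) phi) ->
  itr m S A F s = itr m S' A' F s.
Proof.
move=> mA uF; elim: m s => //= m IH s SS AA.
have {}IH t : itr m S A F t = itr m S' A' F t.
  by apply: IH => [k km|k phi km]; [apply: SS|apply: AA]; exact: ltnW.
rewrite -SS //; case Sm: (S m) => //.
rewrite AA //; last by apply: ucont_upd; exact: itr_uc.
by apply: eq_int1 => x _ _.
Qed.

Lemma itr_le_mass m S A F c s : (forall k, measurable (A k)) -> uc F ->
  (forall s', (forall k, (k < m)%N && S k -> A k (s' k) /\ Ir r (s' k)) ->
     (forall k, ~~ ((k < m)%N && S k) -> s' k = s k) -> F s' <= c) ->
  itr m S A F s <= c * \prod_(k < m | S k) mass r (A k).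
Proof.
move=> mA uF; elim: m s => [|m IH] s H /=.
  by rewrite big_ord0 mulr1; apply: H => k; rewrite ltn0.
have [Sm|Sm] := boolP (S m); last first.
  rewrite big_mkcond big_ord_recr /= (negbTE Sm) mulr1 -big_mkcond; apply: IH => s' h1 h2.
  apply: H => k; rewrite ltnS leq_eqVlt.
    by have [->|_] := eqVneq k m; rewrite /= ?(negbTE Sm) //; exact: h1.
  have [-> _|nk] := eqVneq k m; last exact: h2.
  by rewrite h2 // ltnn.
rewrite big_mkcond big_ord_recr /= Sm -big_mkcond /= mulrA -int1_cst //.
apply: int1_le => //; [by apply: intg_upd; exact: itr_uc|exact: intg_cst|].
move=> x Ax Ix; apply: IH => s' h1 h2; apply: H => k; rewrite ltnS leq_eqVlt.
  have [->|_] := eqVneq k m; last exact: h1.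
  by move=> _; rewrite h2 ?ltnn // upd_same.
have [->|nk] := eqVneq k m; first by rewrite Sm.
by move=> /h2 ->; rewrite upd_other.
Qed.

Lemma itr_mono m S A F G s : (forall k, measurable (A k)) -> uc F -> uc G ->
  (forall s', (forall k, (k < m)%N && S k -> A k (s' k) /\ Ir r (s' k)) ->
     (forall k, ~~ ((k < m)%N && S k) -> s' k = s k) -> F s' <= G s') ->
  itr m S A F s <= itr m S A G s.
Proof.
move=> mA uF uG FG; rewrite -subr_le0 -[itr m S A G s]mul1r -mulNr -itr_lin //.
rewrite -[leRHS](mul0r (\prod_(k < m | S k) mass r (A k))).
apply: itr_le_mass => //; first exact: uc_lin.
by move=> s' h1 h2; rewrite mulN1r subr_le0; exact: FG.
Qed.

Lemma itr_ge_mass m S A F c s : (forall k, measurable (A k)) -> uc F ->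
  (forall s', (forall k, (k < m)%N && S k -> A k (s' k) /\ Ir r (s' k)) ->
     (forall k, ~~ ((k < m)%N && S k) -> s' k = s k) -> c <= F s') ->
  c * \prod_(k < m | S k) mass r (A k) <= itr m S A F s.
Proof.
move=> mA uF H; rewrite -lerN2 -mulNr -[leLHS]mulN1r -itrZ //; apply: itr_le_mass => //.
  have u0 : uc (fun=> 0) by move=> e e0; exists 1 => // *; rewrite subrr normr0 ltW.
  rewrite (_ : (fun _ => _) = fun s => 0 + (- 1) * F s); first exact: uc_lin.
  by apply/funext => t; rewrite add0r.
by move=> s' h1 h2; rewrite mulN1r lerN2; exact: H.
Qed.

(** Each induction step uses [int1_swap] once, to move the integration over variable [i] outside
    that over variable [m]. *)
Lemma itr_swap m i A F s : (forall k, measurable (A k)) -> uc F -> (i < m)%N ->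
  itr m predT A F s = int1 r (A i) (fun x => itr m (predC1 i) A F (upd s i x)).
Proof.
move=> mA uF; elim: m s => // m IH s; rewrite ltnS leq_eqVlt => /predU1P[->|im] /=.
  rewrite eqxx /=; apply: eq_int1 => x _ _; apply: eq_itr => //= k km.
  by rewrite (ltn_eqF km).
rewrite (_ : m != i) ?neq_ltn ?im ?orbT //=.
pose G x y := itr m (predC1 i) A F (upd (upd s i x) m y).
have -> : int1 r (A m) (fun y => itr m predT A F (upd s m y)) =
    int1 r (A m) (fun y => int1 r (A i) (G^~ y)).
  apply: eq_int1 => y _ _; rewrite IH //; apply: eq_int1 => x _ _.
  by rewrite /G [in RHS]updC // neq_ltn im.
by rewrite -int1_swap //; apply: ucont2_upd; exact: itr_uc.
Qed.

(** Entries of the start sequence at integrated variables are overwritten, and [F] ignores those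
    from [n] on. *)
Lemma itr_indep n m S A F s s' :
  (forall s s', (forall k, (k < n)%N -> s k = s' k) -> F s = F s') ->
  (forall k, (k < n)%N -> ~~ ((k < m)%N && S k) -> s k = s' k) ->
  itr m S A F s = itr m S A F s'.
Proof.
move=> Fn; elim: m s s' => [|m IH] s s' H /=; first by apply: Fn => k kn; exact: H.
have [Sm|Sm] := boolP (S m); last first.
  apply: IH => k kn nk; apply: H => //; apply: contra nk => /andP[km Sk].
  move: km; rewrite Sk andbT ltnS leq_eqVlt => /predU1P[E|//].
  by rewrite E (negbTE Sm) in Sk.
apply: eq_int1 => x _ _; apply: IH => k kn nk; rewrite /upd; case: eqP => // /eqP km.
by apply: H => //; rewrite ltnS leq_eqVlt (negbTE km).
Qed.

End Iter.

(** * Sums over words of cells *)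

Section Words.
Variables (R : realType) (r : R) (T : finType) (b0 : T).
Hypothesis r0 : 0 < r.
Local Notation mR := (measurableTypeR R).

(** The default [b0] is reached only at indices from [m] on, which no integration over the first [m]
    variables reads. *)
Definition wext m (a : {ffun 'I_m -> T}) (k : nat) : T :=
  if insub k is Some i then a i else b0.

Lemma wext_ord m (a : {ffun 'I_m -> T}) (i : 'I_m) : wext a i = a i.
Proof. by rewrite /wext valK. Qed.

Lemma sum_ffun_recr m (G : (nat -> T) -> R) :
  (forall a a', (forall k, (k <= m)%N -> a k = a' k) -> G a = G a') ->
  \sum_(a : {ffun 'I_m.+1 -> T}) G (wext a) =
  \sum_b \sum_(a : {ffun 'I_m -> T}) G (upd (wext a) m b).
Proof.
move=> Gm; rewrite pair_big /=.
pose h (p : T * {ffun 'I_m -> T}) : {ffun 'I_m.+1 -> T} :=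
  [ffun i => if unlift ord_max i is Some j then p.2 j else p.1].
rewrite (reindex h) /=; last first.
  exists (fun a => (a ord_max, [ffun j => a (lift ord_max j)])) => [[b a]|a] _ /=.
    by rewrite /h ffunE unlift_none /=; congr pair; apply/ffunP => j; rewrite !ffunE liftK.
  by apply/ffunP => i; rewrite ffunE; case: unliftP => [j|] -> /=; rewrite ?ffunE.
apply: eq_bigr => -[b a] _ /=; apply: Gm => k; rewrite leq_eqVlt => /predU1P[->|km].
  rewrite upd_same; have /= -> := wext_ord (h (b, a)) ord_max.
  by rewrite ffunE unlift_none.
rewrite upd_other ?neq_ltn ?km //.
have /= -> := wext_ord (h (b, a)) (widen_ord (leqnSn m) (Ordinal km)).
have /= -> := wext_ord a (Ordinal km).
have -> : widen_ord (leqnSn m) (Ordinal km) = lift ord_max (Ordinal km).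
  by apply: val_inj => /=; rewrite /bump leqNgt km.
by rewrite ffunE liftK.
Qed.

(** Distributivity, one position at a time: the sum over the last letter is absorbed by the
    outermost integral. The sets [B k b] need only add up to [C k] under integration, so some may be
    empty, as the computation of marginals requires. *)
Lemma itr_words m (B : nat -> T -> set mR) (C : nat -> set mR) F s :
  (forall k b, measurable (B k b)) -> (forall k, measurable (C k)) -> uc F ->
  (forall k phi, ucont phi -> \sum_b int1 r (B k b) phi = int1 r (C k) phi) ->
  \sum_(a : {ffun 'I_m -> T}) itr r m predT (fun k => B k (wext a k)) F s =
  itr r m predT C F s.
Proof.
move=> mB mC uF BC; elim: m s => [|m IH] s.
  rewrite (eq_bigr (fun=> F s)) // sumr_const card_ffun card_ord expn0 mulr1n //.
rewrite (sum_ffun_recr (G := fun a => itr r m.+1 predT (fun k => B k (a k)) F s)); last first.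
  by move=> a a' aa; apply: eq_itr => // k phi km _ _; rewrite aa.
rewrite /= -BC; last by apply: ucont_upd; exact: itr_uc.
apply: eq_bigr => b _; rewrite (eq_int1 (psi := fun x => \sum_(a : {ffun 'I_m -> T})
   itr r m predT (fun k => B k (wext a k)) F (upd s m x))) => [|x _ _]; last by rewrite IH.
rewrite int1_sum // => [|a]; last by apply: intg_upd; exact: itr_uc.
apply: eq_bigr => a _; rewrite upd_same; apply: eq_int1 => x _ _.
apply: eq_itr => // k phi km _ _; rewrite upd_other //.
by rewrite neq_ltn km.
Qed.

End Words.

(** * Extension of functions on the cube by clamping *)

Section Clamp.
Variables (R : realType) (r : R).
Hypothesis r0 : 0 < r.

Definition clamp (x : R) : R := Num.max (- r) (Num.min r x).

Lemma clamp_in x : Ir r (clamp x).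
Proof.
have rr : - r <= r by rewrite ge0_cp // ltW.
by rewrite /Ir /= in_itv /= /clamp le_max lexx /= ge_max ge_min lexx /= andbT.
Qed.

Lemma clamp_id x : Ir r x -> clamp x = x.
Proof.
rewrite /Ir /= in_itv /= => /andP[x1 x2].
by rewrite /clamp (min_idPr x2) (max_idPr x1).
Qed.

Lemma clamp_lip x y : `|clamp x - clamp y| <= `|x - y|.
Proof.
have rr : - r <= r by rewrite ge0_cp // ltW.
have cl a : clamp a = if a <= - r then - r else if a <= r then a else r.
  rewrite /clamp; have [a1|a1] := leP a (- r).
    by rewrite (min_idPr (le_trans a1 rr)) (max_idPl a1).
  have [a2|a2] := leP a r; first by rewrite (max_idPr (ltW a1)).
  by rewrite (max_idPr rr).
have le a b : a <= b -> `|clamp a - clamp b| <= `|a - b|.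
  move=> ab; rewrite [`|a - b|]distrC [`|_ - _|]distrC [leRHS]ger0_norm ?subr_ge0 //.
  rewrite !cl ler_norml; case: (leP a (- r)) => a1; case: (leP a r) => a2;
    case: (leP b (- r)) => b1; case: (leP b r) => b2; apply/andP; split; lra.
by have [/le //|/ltW/le] := leP x y; rewrite distrC [X in _ <= X -> _]distrC.
Qed.

End Clamp.

Section UniformContinuity.
Variables (R : realType) (r : R) (n : nat) (h : 'rV[R]_n -> R).
Hypothesis r0 : 0 < r.
Hypothesis h_cont : {within cube r n, continuous h}.

Lemma cube_compact : compact (cube r n).
Proof.
have := @rV_compact R n (fun=> [set` `[-r, r]]) (fun=> segment_compact (a := -r) (b := r)).
by [].
Qed.

(** Heine-Cantor: around each point [h] varies by less than [e / 2], and compactness in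
    near-covering form yields a common radius. *)
Lemma cube_unif e : 0 < e -> exists2 d, 0 < d & forall x y, cube r n x -> cube r n y ->
  (forall i, `|x ord0 i - y ord0 i| < d) -> `|h x - h y| <= e.
Proof.
move=> e0; have /compact_near_coveringP cov := cube_compact.
pose P (d : R) (x : 'rV[R]_n) := cube r n x -> forall y, cube r n y -> ball x d y ->
  `|h x - h y| <= e.
have : \forall d \near 0^'+, cube r n `<=` P d.
  apply: cov => x cx.
  have /subspace_continuousP/(_ x cx)/cvgrPdist_lt/(_ (e / 2)) := h_cont.
  rewrite divr_gt0 // => /(_ isT).
  rewrite /within /= => /nbhs_ballP[eta /= eta0 H].
  have eta2 : 0 < eta / 2 by rewrite divr_gt0.
  (* Half the radius: both [x'] and any [y] within [d < eta / 2] of it stay in the ball of radius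
     [eta] about [x]. *)
  exists (ball x (eta / 2), [set d | d < eta / 2]) => /=.
    split; first exact: nbhsx_ballx.
    exact: nbhs_right_lt.
  move=> [x' d] /= [bx' dlt] cx' y cy by_.
  have h1 := H x' (le_ball _ bx') cx'; have h2 := H y _ cy.
  have {}h1 : `|h x - h x'| < e / 2 by apply: h1; lra.
  have {}h2 : `|h x - h y| < e / 2.
    apply: h2; rewrite [eta]splitr; apply: ball_triangle bx' _.
    exact: le_ball (ltW dlt) _ by_.
  rewrite distrC in h1; apply: le_trans (ler_distD (h x) _ _) _; lra.
move=> nearP.
have [d [d0 Hd]] : exists d, 0 < d /\ cube r n `<=` P d.
  have : \forall d \near 0^'+, 0 < d /\ cube r n `<=` P d.
    by apply: filterS2 nearP (nbhs_right_gt 0) => d ? ?; split.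
  by move=> /filter_ex.
exists d => // x y cx cy xy; apply: Hd => //; split => // i j.
by rewrite (ord1 i); exact: xy.
Qed.

Lemma cube_bounded : exists M, forall x, cube r n x -> `|h x| <= M.
Proof.
have := continuous_compact h_cont cube_compact.
move=> /compact_bounded [M [Mreal HM]].
exists (M + 1) => x cx; have := HM (M + 1); rewrite ltrDl => /(_ ltr01 (h x)); apply.
by exists x.
Qed.

Definition hc (s : nat -> R) : R := h (\row_(i < n) clamp r (s i)).

Lemma cube_clamp (s : nat -> R) : cube r n (\row_(i < n) clamp r (s i)).
Proof. by move=> i; rewrite mxE; exact: clamp_in. Qed.

Lemma hc_uc : uc hc.
Proof.
move=> e /cube_unif[d d0 H]; exists (d / 2); first by rewrite divr_gt0.
move=> s s' ss; apply: H; try exact: cube_clamp.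
move=> i; rewrite !mxE; apply: le_lt_trans (clamp_lip _ _ _) _ => //.
by apply: le_lt_trans (ss i) _; lra.
Qed.

Lemma hc_bounded : exists M, forall s, `|hc s| <= M.
Proof.
by have [M HM] := cube_bounded; exists M => s; apply: HM; exact: cube_clamp.
Qed.

End UniformContinuity.

Section UcOps.
Variable R : realType.
Implicit Types F G : (nat -> R) -> R.

Lemma uc_mul F G M : (forall s, `|F s| <= M) -> (forall s, `|G s| <= M) ->
  uc F -> uc G -> uc (fun s => F s * G s).
Proof.
move=> FM GM uF uG e e0.
have M1 : 0 < M + 1 by apply: ltr_wpDl => //; exact: le_trans (FM (fun=> 0)).
have e1 : 0 < e / (2 * (M + 1)) by rewrite divr_gt0 // mulr_gt0.
have [d d0 H] := uF _ e1; have [d' d'0 H'] := uG _ e1.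
exists (Num.min d d'); first by rewrite lt_min d0.
move=> s s' ss.
have h1 : `|F s - F s'| <= e / (2 * (M + 1)).
  by apply: H => k; apply: le_trans (ss k) _; rewrite ge_min lexx.
have h2 : `|G s - G s'| <= e / (2 * (M + 1)).
  by apply: H' => k; apply: le_trans (ss k) _; rewrite ge_min lexx orbT.
have -> : F s * G s - F s' * G s' = F s * (G s - G s') + (F s - F s') * G s' by ring.
apply: le_trans (ler_normD _ _) _; rewrite !normrM.
have -> : e = (M + 1) * (e / (2 * (M + 1))) + (e / (2 * (M + 1))) * (M + 1).
  by field; rewrite gt_eqF.
by apply: lerD; apply: ler_pM => //; apply: le_trans (FM _) _ || apply: le_trans (GM _) _; lra.
Qed.

Lemma uc_expR F M : (forall s, `|F s| <= M) -> uc F -> uc (fun s => expR (F s)).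
Proof.
move=> FM uF e e0.
have le a b : b <= M -> expR b - expR a <= expR M * `|b - a|.
  move=> bM; have -> : expR b - expR a = expR b * (1 - expR (a - b)).
    by rewrite mulrBr mulr1 -expRD [b + _]addrC subrK.
  have := expR_ge1Dx (a - b) => h.
  apply: (@le_trans _ _ (expR b * `|b - a|)).
    by apply: ler_wpM2l; [exact: expR_ge0|have := ler_norm (b - a); lra].
  by apply: ler_wpM2r; rewrite // ler_expR.
have /uF[d d0 H] : 0 < e / expR M by rewrite divr_gt0 // expR_gt0.
exists d => // s s' ss; have := H _ _ ss; rewrite ler_pdivlMr ?expR_gt0 // mulrC => h.
have m1 : F s' <= M := le_trans (ler_norm _) (FM s').
have m2 : F s <= M := le_trans (ler_norm _) (FM s).
rewrite ler_norml lerNl opprB; apply/andP; split.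
  by apply: le_trans (le _ _ m1) _; rewrite distrC.
exact: le_trans (le _ _ m2) _.
Qed.

End UcOps.

(** * The Gibbs density *)

Section IterDefs.
Variables (R : realType) (r : R).
Hypothesis r0 : 0 < r.
Local Notation mR := (measurableTypeR R).
Local Notation allT := (fun _ : nat => setT : set mR).
Implicit Types (F : (nat -> R) -> R) (s : nat -> R).

Definition seqIr s := forall k, Ir r (s k).

Lemma seqIr_upd s k x : seqIr s -> Ir r x -> seqIr (upd s k x).
Proof. by move=> Is Ix j; rewrite /upd; case: eqP. Qed.

(** Integration writes only values from $[-r,r]$, so agreement on such sequences is enough; this is
    what lets the clamped extension stand for [h]. *)
Lemma iint_auxE m S (Fe : (nat -> R) -> \bar R) F s : uc F ->
  (forall s, seqIr s -> Fe s = (F s)%:E) -> seqIr s ->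
  iint_aux r m S Fe s = (itr r m S allT F s)%:E.
Proof.
move=> uF FE; elim: m s => [|m IH] s Is /=; first exact: FE.
case: (S m); last exact: IH.
have := @int1E R r setT (fun x => itr r m S allT F (upd s m x)) measurableT.
rewrite setTI => <-; last by apply: intg_upd; exact: itr_uc.
by apply: eq_integral => x; rewrite inE => Ix; apply: IH; exact: seqIr_upd.
Qed.

(** Once variable [i] is integrated the indicator restricts its domain; before that it is a constant
    factor. Hence the case distinction in the statement proved by induction. *)
Lemma iint_aux_ind m i (A : set mR) (Fe : (nat -> R) -> \bar R) F s :
  measurable A -> uc F ->
  (forall s, seqIr s -> Fe s = (\1_A (s i) * F s)%:E) -> seqIr s ->
  iint_aux r m predT Fe s =
    (if (i < m)%N then itr r m predT (fun k => if k == i then A else setT) F s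
     else \1_A (s i) * itr r m predT allT F s)%:E.
Proof.
move=> mA uF FE; elim: m s => [|m IH] s Is /=; first exact: FE.
have mA' k : measurable (if k == i then A else setT) by case: eqP.
have E x : Ir r x -> iint_aux r m predT Fe (upd s m x) = _ := fun Ix => IH _ (seqIr_upd _ Is Ix).
rewrite ltnS leq_eqVlt; have [im|im] := eqVneq i m.
  subst i; rewrite ltnn in E; rewrite /=.
  rewrite -int1E //; last by apply: intg_upd; apply: itr_uc.
  rewrite setIC integral_mkcondr; apply: eq_integral => x; rewrite inE => Ix.
  rewrite E // upd_same /patch indicE; case: ifP => xA; rewrite ?mul1r ?mul0r //.
  by congr EFin; apply: eq_itr => // k phi km _ _; rewrite ltn_eqF.
case: ltnP E => im' E /=.
  have := @int1E R r setT (fun x => itr r m predT (fun k => if k == i then A else setT) F (upd s m x)) measurableT.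
  rewrite setTI => <-; last by apply: intg_upd; exact: itr_uc.
  by apply: eq_integral => x; rewrite inE => Ix; rewrite E.
rewrite -int1Z //; last by apply: intg_upd; exact: itr_uc.
have := @int1E R r setT (fun x => \1_A (s i) * itr r m predT allT F (upd s m x)) measurableT.
rewrite setTI => <-; last by apply: intgZ; apply: intg_upd; exact: itr_uc.
by apply: eq_integral => x; rewrite inE => Ix; rewrite E // upd_other.
Qed.

End IterDefs.

Section Gibbs.
Variables (R : realType) (r : R) (n : nat) (h : 'rV[R]_n -> R).
Hypothesis r0 : 0 < r.
Hypothesis h_cont : {within cube r n, continuous h}.
Local Notation mR := (measurableTypeR R).
Local Notation allT := (fun _ : nat => setT : set mR).
Local Notation zs := (fun _ : nat => 0 : R).

Definition eh (s : nat -> R) : R := expR (hc r h s).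
Definition partfun : R := itr r n predT allT eh zs.
(** On $[-r,r]$ this is $e^{h_i}$. The zeros of [zs] at the other positions below [n] are
    overwritten by the integration. *)
Definition margfun (i : 'I_n) (x : R) : R :=
  itr r n (predC1 (i : nat)) allT eh (upd zs i x).
Definition gibbsdens (i : 'I_n) (x : R) : R := expR (- pressure r h) * margfun i x.

Lemma eh_uc : uc eh.
Proof.
by have [M HM] := hc_bounded r0 h_cont; apply: uc_expR HM _; exact: hc_uc.
Qed.

Lemma seqIr0 : seqIr r zs.
Proof. by move=> k; rewrite /Ir /= in_itv /= oppr_le0 ltW. Qed.

Lemma hc_row (s : nat -> R) : seqIr r s -> hc r h s = h (\row_(i < n) s i).
Proof.
by move=> Is; congr h; apply/rowP => i; rewrite !mxE clamp_id.
Qed.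

Lemma itr_eh_gt0 S (A : nat -> set mR) s : (forall k, measurable (A k)) ->
  (forall k, 0 < mass r (A k)) -> 0 < itr r n S A eh s.
Proof.
move=> mA A0; have [M HM] := hc_bounded r0 h_cont.
apply: (@lt_le_trans _ _ (expR (- M) * \prod_(k < n | S k) mass r (A k))).
  by rewrite mulr_gt0 ?expR_gt0 // prodr_gt0.
apply: itr_ge_mass => //; first exact: eh_uc.
by move=> s' _ _; rewrite ler_expR; have := HM s'; rewrite ler_norml => /andP[].
Qed.

Lemma massT_gt0 : 0 < mass r (setT : set mR).
Proof. by rewrite mass_setT // mulr_gt0. Qed.

Lemma partfun_gt0 : 0 < partfun.
Proof. by apply: itr_eh_gt0 => // k; exact: massT_gt0. Qed.

Lemma pressureE : pressure r h = ln partfun.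
Proof.
rewrite /pressure /cube_int (iint_auxE r0 n predT eh_uc) //; last exact: seqIr0.
by move=> s Is; rewrite /eh hc_row.
Qed.

Lemma expR_pressure : expR (pressure r h) = partfun.
Proof. by rewrite pressureE lnK // posrE partfun_gt0. Qed.

Lemma margfun_ucont i : ucont (margfun i).
Proof. by apply: ucont_upd; apply: itr_uc => //; exact: eh_uc. Qed.

Lemma margfun_gt0 i x : 0 < margfun i x.
Proof. by apply: itr_eh_gt0 => // k; exact: massT_gt0. Qed.

Lemma margfun_int1 (i : 'I_n) (A : set mR) : measurable A ->
  itr r n predT (fun k => if k == i then A else setT) eh zs = int1 r A (margfun i).
Proof.
move=> mA; have mA' (k : nat) : measurable (if k == i then A else setT) by case: eqP.
rewrite (itr_swap r0 _ mA' eh_uc (ltn_ord i)) eqxx; apply: eq_int1 => x _ _.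
apply: eq_itr => //; first exact: eh_uc.
by move=> k phi _ /= /negbTE ->.
Qed.

Lemma partfun_margfun i : partfun = int1 r setT (margfun i).
Proof.
rewrite -margfun_int1 //; apply: eq_itr => //; first exact: eh_uc.
by move=> k phi _ _ _; case: eqP.
Qed.

Lemma gibbsdens_ucont i : ucont (gibbsdens i).
Proof.
have c0 : 0 < expR (- pressure r h) by exact: expR_gt0.
move=> e e0; have [d d0 H] := margfun_ucont i (divr_gt0 e0 c0).
exists d => // x y xy; rewrite /gibbsdens -mulrBr normrM gtr0_norm //.
by rewrite mulrC -ler_pdivlMr //; exact: H.
Qed.

Lemma gibbsdens_gt0 i x : 0 < gibbsdens i x.
Proof. by rewrite mulr_gt0 ?expR_gt0 ?margfun_gt0. Qed.

Lemma int1_gibbsdens i (A : set mR) : measurable A ->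
  int1 r A (gibbsdens i) = expR (- pressure r h) * int1 r A (margfun i).
Proof. by move=> mA; rewrite int1Z //; exact/ucont_intg/margfun_ucont. Qed.

Lemma int1_gibbsdensT i : int1 r setT (gibbsdens i) = 1.
Proof.
rewrite int1_gibbsdens // -partfun_margfun expRN expR_pressure mulVf //.
by rewrite gt_eqF // partfun_gt0.
Qed.

(** [hmarg] starts from the sequence constantly equal to [x], [margfun] from zeros with [x] at [i];
    below [n] they differ only at integrated variables. *)
Lemma hmargE i x : Ir r x -> expR (hmarg r h i x) = margfun i x.
Proof.
move=> Ix; rewrite /hmarg (iint_auxE r0 n _ eh_uc) //; last first.
  by move=> s Is; rewrite /eh hc_row.
rewrite /= lnK ?posrE; last by apply: itr_eh_gt0 => // k; exact: massT_gt0.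
apply: (@itr_indep _ _ n) => [s s' ss|k kn].
  rewrite /eh /hc; congr (expR (h _)); apply/rowP => j; rewrite !mxE ss //.
by rewrite kn /= negbK => /eqP ->; rewrite upd_same.
Qed.

(** Together with [gibbs_marginalE] this makes conditions (ii) and (iii) the same: both measures
    have density [gibbsdens]. *)
Lemma gibbs1E i (A : set mR) : measurable A ->
  gibbs1 r (hmarg r h i) A = (int1 r A (gibbsdens i))%:E.
Proof.
move=> mA; have iE (B : set mR) : measurable B ->
    (\int[lam (R:=R)]_(x in B `&` Ir r) (expR (hmarg r h i x))%:E)%E = (int1 r B (margfun i))%:E.
  move=> mB; rewrite -int1E //; last exact/ucont_intg/margfun_ucont.
  by apply: eq_integral => x; rewrite inE => -[_ Ix]; rewrite hmargE.
rewrite /gibbs1 iE // int1_gibbsdens // EFinM; congr (_ * _)%E.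
rewrite /pressure1; have := iE setT measurableT; rewrite setTI => -> /=.
by rewrite -partfun_margfun -pressureE.
Qed.

Lemma gibbs_marginalE i (A : set mR) : measurable A ->
  gibbs_marginal r h i A = (int1 r A (gibbsdens i))%:E.
Proof.
move=> mA; rewrite /gibbs_marginal /cube_int (iint_aux_ind r0 n (i := i) mA eh_uc) //.
- by rewrite ltn_ord margfun_int1 // int1_gibbsdens // EFinM.
- by move=> s Is; rewrite /eh hc_row // mxE.
- exact: seqIr0.
Qed.

End Gibbs.

(** * Step polynomials and convergence of frequencies *)

Lemma bernoulli_ineq (R : realDomainType) (u : R) n : 0 <= u <= 1 ->
  1 - n%:R * u <= (1 - u) ^+ n.
Proof.
move=> /andP[u0 u1]; elim: n => [|n IH]; first by rewrite mul0r subr0 expr0.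
have u1' : 0 <= 1 - u by rewrite subr_ge0.
rewrite exprS; apply: le_trans (ler_wpM2l u1' IH).
have : 0 <= n%:R * u ^+ 2 by rewrite mulr_ge0 // sqr_ge0.
by rewrite -natr1 => H; rewrite -subr_ge0; apply: le_trans H _; rewrite le_eqVlt; apply/orP; left; apply/eqP; ring.
Qed.

(* The polynomials [1 - (1 - y^m)^(2^m)] tend to the indicator of [y > 1/2] on [0,1]. *)
Lemma step_poly (R : realType) (r t dl e : R) : 0 < r -> 0 < dl -> 0 < e ->
  exists p : {poly R}, forall x, Ir r x ->
    [/\ 0 <= p.[x] <= 1, t <= x -> 1 - e <= p.[x] & x <= t - dl -> p.[x] <= e].
Proof.
(* [c] is large enough for the affine map [Y], with value 1/2 at [t - dl / 2], to send $[-r,r]$ into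
   $[0,1]$; [eta] is [dl / 2] after this scaling. *)
move=> r0 dl0 e0; pose c := 2 * (r + `|t| + dl).
have t0 := normr_ge0 t; have tt := ler_norm t; have tN : - `|t| <= t.
  by have := ler_norm (- t); rewrite normrN; lra.
have c0 : 0 < c by rewrite /c; lra.
pose eta := dl / (2 * c).
have eta0 : 0 < eta by rewrite divr_gt0 // mulr_gt0.
have eta4 : eta <= 1 / 4 by rewrite ler_pdivrMr ?mulr_gt0 // /c; lra.
have [m1 H1] : exists n0, forall n, (n0 <= n)%N -> 1 * (1 - 2 * eta) ^+ n <= e.
  by apply: geometric_eventually_le => //; apply/andP; split; lra.
have [m2 H2] : exists n0, forall n, (n0 <= n)%N -> 1 * (1 + 2 * eta)^-1 ^+ n <= e.
  apply: geometric_eventually_le => //; rewrite invr_ge0 invf_lt1; last by lra.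
  by apply/andP; split; lra.
pose m := maxn m1 m2.
have [Y YE] : exists Y : {poly R}, forall x, Y.[x] = (x - (t - dl / 2)) / c + 1 / 2.
  exists (c^-1 *: ('X - (t - dl / 2)%:P) + (1 / 2)%:P) => x.
  by rewrite hornerD hornerZ hornerXsubC hornerC mulrC.
exists (1 - (1 - Y ^+ m) ^+ (2 ^ m)%N) => x; rewrite /Ir /= in_itv /= => /andP[x1 x2].
rewrite !(hornerD, hornerN, horner_exp, hornerC); set y := Y.[x].
have yE : y = (x - (t - dl / 2)) / c + 1 / 2 by exact: YE.
have y0 : 0 <= y.
  rewrite yE -lerBlDr sub0r ler_pdivlMr //; rewrite /c; lra.
have y1 : y <= 1.
  rewrite yE -lerBrDr ler_pdivrMr //; rewrite /c; lra.
have ym : 0 <= y ^+ m <= 1 by rewrite exprn_ge0 // exprn_ile1.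
have [ym0 ym1] := andP ym.
have z0 : 0 <= (1 - y ^+ m) ^+ (2 ^ m)%N by rewrite exprn_ge0 // subr_ge0.
have z1 : (1 - y ^+ m) ^+ (2 ^ m)%N <= 1 by rewrite exprn_ile1 // ?subr_ge0 //; lra.
(* The exponent $2^m$ puts the threshold at 1/2. Below it, Bernoulli gives a value of at most
   $(2y)^m$ with $2y \le 1 - 2\eta$; above it, [b1] bounds the defect by $e^{-(2y)^m} \le (2y)^{-m}$
   with $2y \ge 1 + 2\eta$. *)
have b0 := bernoulli_ineq (2 ^ m)%N ym.
have b1 : (1 - y ^+ m) ^+ (2 ^ m)%N <= expR (- y ^+ m) ^+ (2 ^ m)%N.
  apply: lerXn2r; rewrite ?nnegrE ?expR_ge0 ?subr_ge0 //; exact: expR_ge1Dx.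
set z := (1 - y ^+ m) ^+ (2 ^ m)%N in z0 z1 b0 b1 *.
split; first by rewrite subr_ge0 z1 gerBl.
  move=> tx; have y2 : 1 + 2 * eta <= 2 * y.
    have : eta <= (x - (t - dl / 2)) / c.
      by rewrite /eta invfM mulrA ler_pM2r ?invr_gt0 //; lra.
    by rewrite yE; lra.
  rewrite lerD2l lerN2.
  apply: le_trans (H2 m (leq_maxr _ _)); rewrite mul1r.
  apply: (@le_trans _ _ (expR (- (2 * y) ^+ m))).
    have -> : - (2 * y) ^+ m = - y ^+ m * (2 ^ m)%:R by rewrite exprMn natrX; ring.
    by rewrite expRM_natr.
  rewrite expRN exprVn lef_pV2 ?posrE ?expR_gt0 ?exprn_gt0 //; last by lra.
  apply: (@le_trans _ _ ((2 * y) ^+ m)); first by apply: lerXn2r; rewrite ?nnegrE; lra.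
  by have := expR_ge1Dx ((2 * y) ^+ m); lra.
move=> xt; have y2 : 2 * y <= 1 - 2 * eta.
  have : (x - (t - dl / 2)) / c <= - eta.
    have -> : - eta = - (dl / 2) / c by rewrite /eta invfM; ring.
    by rewrite ler_pM2r ?invr_gt0 //; lra.
  by rewrite yE; lra.
apply: le_trans (H1 m (leq_maxl _ _)); rewrite mul1r.
rewrite natrX -exprMn in b0.
apply: (@le_trans _ _ ((2 * y) ^+ m)); first by rewrite lerBlDr addrC -lerBlDr.
by apply: lerXn2r; rewrite ?nnegrE; lra.
Qed.

(** * Expectations and tails of a measure on the interval *)

Section Expectation.
Variables (R : realType) (r : R).
Hypothesis r0 : 0 < r.
Variable mu : probability (measurableTypeR R) R.
Hypothesis mu1 : prob_on_cube r mu.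
Local Notation mR := (measurableTypeR R).

Definition Ex (phi : R -> R) : R := \int[mu]_(x in Ir r) phi x.

Lemma bounded_mu_integrable (D : set mR) (phi : R -> R) M : measurable D ->
  measurable_fun D (phi : mR -> R) -> (forall x, D x -> `|phi x| <= M) ->
  mu.-integrable D (EFin \o phi).
Proof.
move=> mD mphi phiM; apply: measurable_bounded_integrable => //.
  by apply: le_lt_trans (probability_le1 _ mD) _; exact: ltry.
exists M; split; first exact: num_real.
by move=> M' MM' x Dx; apply: le_trans (phiM x Dx) _; exact: ltW.
Qed.

Lemma continuous_mu_integrable phi : continuous phi ->
  mu.-integrable (Ir r) (EFin \o phi).
Proof.
move=> cphi.
have : compact (phi @` Ir r).
  apply: continuous_compact; last exact: segment_compact.
  exact: continuous_subspaceT.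
move=> /compact_bounded[M [_ HM]].
apply: (@bounded_mu_integrable _ _ (M + 1)); first exact: measurable_Ir.
  by apply: measurable_funS (continuous_measurable_fun cphi) => //.
move=> x Ix; apply: (HM (M + 1)); first by rewrite ltrDl.
by exists x.
Qed.

Lemma poly_continuous (p : {poly R}) : continuous (fun x => p.[x]).
Proof. exact: continuous_horner. Qed.

Lemma mu_setC : mu (~` Ir r) = 0%E.
Proof.
by rewrite probability_setC ?mu1 ?subee //; exact: measurable_Ir.
Qed.

Lemma integral_mu_Ir phi : continuous phi ->
  (\int[mu]_x (phi x)%:E)%E = (Ex phi)%:E.
Proof.
move=> cphi; have icphi := continuous_mu_integrable cphi.
have mC : measurable (~` Ir r : set mR) by apply: measurableC; exact: measurable_Ir.
have TD : [set: mR] `\` ~` Ir r = Ir r by rewrite setTD setCK.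
have ii : mu.-integrable setT (EFin \o phi).
  apply/(negligible_integrable mC measurableT _ mu_setC); rewrite ?TD //.
  by apply/measurable_EFinP; exact: continuous_measurable_fun.
rewrite (negligible_integral mC measurableT ii mu_setC) TD.
rewrite /Ex /Rintegral fineK //; apply: integrable_fin_num => //; exact: measurable_Ir.
Qed.

Lemma mu_capIr (A : set mR) : measurable A -> mu (A `&` Ir r) = mu A.
Proof.
move=> mA; have mI := @measurable_Ir R r.
have D0 : mu (A `\` Ir r) = 0%E.
  apply/eqP; rewrite eq_le measure_ge0 andbT -mu_setC; apply: le_measure; rewrite ?inE.
  - exact: measurableD.
  - exact: measurableC.
  - by move=> x [].
by apply: esym; apply: etrans (measureDI mu mA mI) _; rewrite [X in (X + _)%E]D0 add0e.
Qed.

Lemma ExD phi psi : mu.-integrable (Ir r) (EFin \o phi) ->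
  mu.-integrable (Ir r) (EFin \o psi) ->
  Ex (fun x => phi x + psi x) = Ex phi + Ex psi.
Proof. by move=> i1 i2; apply: RintegralD => //; exact: measurable_Ir. Qed.

Lemma ExZ c phi : mu.-integrable (Ir r) (EFin \o phi) ->
  Ex (fun x => c * phi x) = c * Ex phi.
Proof. by move=> i1; apply: RintegralZl => //; exact: measurable_Ir. Qed.

Lemma Ex_le phi psi : mu.-integrable (Ir r) (EFin \o phi) ->
  mu.-integrable (Ir r) (EFin \o psi) ->
  (forall x, Ir r x -> phi x <= psi x) -> Ex phi <= Ex psi.
Proof. by move=> i1 i2 le; apply: le_Rintegral => //; exact: measurable_Ir. Qed.

Lemma Ex_cst c : Ex (cst c) = c.
Proof.
have -> : Ex (cst c) = c * fine (mu (Ir r)) by apply: Rintegral_cst; exact: measurable_Ir.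
by rewrite mu1 mulr1.
Qed.

Lemma cst_mu_integrable c : mu.-integrable (Ir r) (EFin \o (fun=> c)).
Proof. by apply: continuous_mu_integrable; exact: cst_continuous. Qed.

Definition ray (t : R) : set mR := `[t, +oo[%classic.

Lemma measurable_ray t : measurable (ray t).
Proof. exact: measurable_itv. Qed.

Lemma indic_mu_integrable (A : set mR) : measurable A ->
  mu.-integrable (Ir r) (EFin \o (\1_A : R -> R)).
Proof.
move=> mA; apply: (@bounded_mu_integrable _ _ 1); first exact: measurable_Ir.
  exact: measurable_indic.
by move=> x _; rewrite indicE; case: (_ \in _); rewrite ?normr1 ?normr0.
Qed.

Lemma Ex_indic (A : set mR) : measurable A -> Ex (\1_A : R -> R) = fine (mu A).
Proof.
move=> mA; rewrite /Ex /Rintegral -(mu_capIr mA); congr fine.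
by apply: integral_indic => //; exact: measurable_Ir.
Qed.

Lemma Ex_poly (p : {poly R}) : Ex (fun x => p.[x]) =
  \sum_(k < size p) p`_k * Ex (fun x => x ^+ k).
Proof.
have ck (k : nat) : mu.-integrable (Ir r) (EFin \o (fun x : R => x ^+ k)).
  by apply: continuous_mu_integrable; exact: exprn_continuous.
transitivity (Ex (fun x => \sum_(k < size p) p`_k * x ^+ k)).
  by apply: eq_Rintegral => x _; rewrite horner_coef.
elim: (size p) => [|m IH].
  rewrite big_ord0 -[RHS](Ex_cst 0); apply: eq_Rintegral => x _.
  by rewrite big_ord0.
rewrite big_ord_recr /= -IH -ExZ // -ExD; last 2 first.
- apply: continuous_mu_integrable.
  have -> : (fun x => \sum_(k < m) p`_k * x ^+ k) = (fun x => (\poly_(k < m) p`_k).[x]).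
    by apply/funext => x; rewrite horner_poly.
  exact: poly_continuous.
- by apply: continuous_mu_integrable => x; apply: cvgM; [exact: cvg_cst|exact: exprn_continuous].
by apply: eq_Rintegral => x _; rewrite big_ord_recr.
Qed.

Lemma fin_prob (A : set mR) : measurable A -> (fine (mu A))%:E = mu A.
Proof.
move=> mA; rewrite fineK // ge0_fin_numE ?measure_ge0 //.
by apply: le_lt_trans (probability_le1 _ mA) _; exact: ltry.
Qed.

Definition tail (t : R) : R := fine (mu (ray t)).

Lemma tailE t : (tail t)%:E = mu (ray t).
Proof. by rewrite fin_prob //; exact: measurable_ray. Qed.

(** Up to [e], the polynomial lies between the indicators of [ray t] and [ray (t - dl)]. *)
Lemma step_poly_tail t dl e : 0 < dl -> 0 < e -> exists2 p : {poly R},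
  forall x, Ir r x ->
    [/\ 0 <= p.[x] <= 1, t <= x -> 1 - e <= p.[x] & x <= t - dl -> p.[x] <= e] &
  tail t - e <= Ex (fun x => p.[x]) <= tail (t - dl) + e.
Proof.
move=> dl0 e0; have [p Hp] := step_poly t r0 dl0 e0; exists p => //.
have ip : mu.-integrable (Ir r) (EFin \o (fun x => p.[x])).
  by apply: continuous_mu_integrable; exact: poly_continuous.
have ic := cst_mu_integrable e.
have iI u := indic_mu_integrable (measurable_ray u).
rewrite /tail -!Ex_indic; try exact: measurable_ray.
rewrite lerBlDr -[X in _ <= _ + X](Ex_cst e) -[X in _ && (_ <= _ + X)](Ex_cst e) -!ExD //.
apply/andP; split; apply: Ex_le => //.
- by have := integrableD (@measurable_Ir R r) ip ic.
- move=> x Ix; have [/andP[p0 p1] pe _] := Hp x Ix; rewrite indicE.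
  case: (boolP (x \in _)); last by move=> _ /=; lra.
  by rewrite inE /ray /= in_itv /= andbT => /pe; lra.
- by have := integrableD (@measurable_Ir R r) (iI (t - dl)) ic.
move=> x Ix; have [/andP[p0 p1] _ pe] := Hp x Ix; rewrite indicE.
have [xt|xt] := leP x (t - dl); first by apply: le_trans (pe xt) _; rewrite lerDr.
rewrite mem_set; first by rewrite /=; lra.
by rewrite /ray /= in_itv /= andbT ltW.
Qed.

(** [ray t] is the intersection of the closed rays that start to its left, so continuity from above
    applies. *)
Lemma tail_left t e : 0 < e -> exists2 dl, 0 < dl & tail (t - dl) <= tail t + e.
Proof.
move=> e0; pose F k := ray (t - k.+1%:R^-1).
have : (mu \o F) x @[x --> \oo] --> mu (\bigcap_k F k).
  apply: nonincreasing_cvg_mu => //.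
  - by apply: le_lt_trans (probability_le1 _ (measurable_ray _)) _; exact: ltry.
  - by move=> k; exact: measurable_ray.
  - by apply: bigcap_measurable => // k _; exact: measurable_ray.
  move=> k l kl; apply/subsetPset => x; rewrite /F /ray /= !in_itv /= !andbT.
  by apply: le_trans; rewrite lerD2l lerN2 lef_pV2 ?posrE // ler_nat ltnS.
have -> : \bigcap_k F k = ray t.
  apply/seteqP; split => x; rewrite /F /ray /= ?in_itv /= ?andbT => H.
    apply/ler_addgt0Pr => eps eps0.
    have := H (Num.truncn (eps^-1)) I; rewrite /= in_itv /= andbT lerBlDr => /le_trans; apply.
    rewrite lerD2l invf_ple ?posrE //; first exact/ltW/truncnS_gt.
  move=> k _; rewrite /= in_itv /= andbT; apply: le_trans H.
  by rewrite gerDl oppr_le0.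
rewrite -tailE => /fine_cvgP[_] /cvgrPdist_le /(_ e e0)[k _ /(_ k (leqnn k)) /=].
rewrite ler_distlC => /andP[_ H].
by exists k.+1%:R^-1.
Qed.

(** Rays starting to the right of [t] exhaust only the open ray, so an atom at [t] has to be
    excluded. *)
Lemma tail_right t e : mu [set t] = 0%E -> 0 < e ->
  exists2 dl, 0 < dl & tail t <= tail (t + dl) + e.
Proof.
move=> mut e0; pose F k := ray (t + k.+1%:R^-1).
have mT : measurable (`]t, +oo[%classic : set mR) by exact: measurable_itv.
have UF : \bigcup_k F k = `]t, +oo[%classic.
  apply/seteqP; split => x; rewrite /F /ray /= ?in_itv /= ?andbT.
    by move=> [k _]; rewrite /= in_itv /= andbT; apply: lt_le_trans; rewrite ltrDl.
  move=> tx; exists (Num.truncn ((x - t)^-1)) => //=; rewrite in_itv /= andbT.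
  rewrite -lerBrDl invf_ple ?posrE ?subr_gt0 //; exact/ltW/truncnS_gt.
have : (mu \o F) x @[x --> \oo] --> mu (\bigcup_k F k).
  apply: nondecreasing_cvg_mu => //.
  - by move=> k; exact: measurable_ray.
  - by rewrite UF.
  move=> k l kl; apply/subsetPset => x; rewrite /F /ray /= !in_itv /= !andbT.
  by apply: le_trans; rewrite lerD2l lef_pV2 ?posrE // ler_nat ltnS.
have -> : mu (\bigcup_k F k) = mu (ray t).
  have -> : ray t = [set t] `|` `]t, +oo[ by rewrite /ray -(@setU1itv _ _ +oo%O t false).
  rewrite UF; apply: esym; apply: etrans (measureU mu _ mT _) _.
  - exact: measurable_set1.
  - by apply/seteqP; split => // x [/= ->]; rewrite in_itv /= ltxx.
  - by rewrite [X in (X + _)%E]mut add0e.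
rewrite -tailE => /fine_cvgP[_] /cvgrPdist_le /(_ e e0)[k _ /(_ k (leqnn k)) /=].
rewrite ler_distl => /andP[_ H].
by exists k.+1%:R^-1.
Qed.

End Expectation.

(** * From convergence of moments to cell frequencies *)

Section Frequencies.
Variables (R : realType) (r : R).
Hypothesis r0 : 0 < r.
Variable mu : probability (measurableTypeR R) R.
Hypothesis mu1 : prob_on_cube r mu.
Variable xi : forall N, 'I_N -> R.
Hypothesis xiI : forall N j, Ir r (@xi N j).
Hypothesis xi_cvg : forall k,
  (fun N => ((N%:R)^-1 * \sum_(j < N) @xi N j ^+ k)%:E) @ \oo -->
  (\int[mu]_x (x ^+ k)%:E)%E.

Definition mean N (phi : R -> R) : R := (N%:R)^-1 * \sum_(j < N) phi (@xi N j).

Lemma mean_poly_cvg (p : {poly R}) :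
  (fun N => mean N (fun x => p.[x])) @ \oo --> Ex r mu (fun x => p.[x]).
Proof.
rewrite Ex_poly //.
have -> : (fun N => mean N (fun x => p.[x])) =
    (fun N => \sum_(k < size p) p`_k * mean N (fun x => x ^+ k)).
  apply/funext => N; rewrite /mean (eq_bigr (fun j => \sum_(k < size p) p`_k * @xi N j ^+ k)).
    rewrite exchange_big mulr_sumr; apply: eq_bigr => k _.
    by rewrite mulrCA -mulr_sumr.
  by move=> j _; rewrite horner_coef.
elim: (size p) => [|m IH].
  under eq_fun do rewrite big_ord0.
  by rewrite big_ord0; exact: cvg_cst.
under eq_fun do rewrite big_ord_recr.
rewrite big_ord_recr /=; apply: cvgD => //; apply: cvgMr.
have := @xi_cvg m; rewrite (integral_mu_Ir mu1); last exact: exprn_continuous.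
by move=> /fine_cvgP[_].
Qed.

Lemma mean_le phi psi e N : 0 <= e -> (forall x, Ir r x -> phi x <= psi x + e) ->
  mean N phi <= mean N psi + e.
Proof.
move=> e0 H; have [->|N0] := posnP N.
  by rewrite /mean invr0 !mul0r add0r.
have Nn : (N%:R : R) != 0 by rewrite pnatr_eq0 -lt0n.
rewrite -[X in _ + X](mulKf Nn) -mulrDr ler_wpM2l ?invr_ge0 //.
rewrite mulr_natl -[X in _ *+ X](card_ord N) -sumr_const -big_split /=.
by apply: ler_sum => j _; exact: H.
Qed.

(** Four errors of [e / 4]: domination of the indicator by a step polynomial, convergence of its
    empirical mean, its expectation against [tail mu (t - dl)], and the left limit of the tail. *)
Lemma freq_upper (t e : R) : 0 < e ->
  \forall N \near \oo, mean N (fun x => (t <= x)%R%:R) <= tail mu t + e.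
Proof.
move=> e0; have e4 : 0 < e / 4 by rewrite divr_gt0.
have [dl dl0 Hdl] := tail_left mu t e4.
have [p Hp /andP[_ Ep]] := step_poly_tail r0 mu1 t dl0 e4.
have := @mean_poly_cvg p => /cvgrPdist_le /(_ _ e4); apply: filterS => N.
rewrite ler_distlC => /andP[_ H].
have := @mean_le (fun x => (t <= x)%R%:R) (fun x => p.[x]) (e / 4) N (ltW e4).
have le x : Ir r x -> (t <= x)%R%:R <= p.[x] + e / 4.
  move=> Ix; have [/andP[p0 p1] pt _] := Hp x Ix.
  by have [/pt|_] := leP t x => /=; lra.
by move=> /(_ le); lra.
Qed.

(** Here the polynomial rises between [t] and [t + dl], to lie below the indicator; the comparison
    then needs the right limit of the tail. *)
Lemma freq_lower (t e : R) : mu [set t] = 0%E -> 0 < e ->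
  \forall N \near \oo, tail mu t - e <= mean N (fun x => (t <= x)%R%:R).
Proof.
move=> mut e0; have e4 : 0 < e / 4 by rewrite divr_gt0.
have [dl dl0 Hdl] := tail_right mut e4.
have [p Hp /andP[Ep _]] := step_poly_tail r0 mu1 (t + dl) dl0 e4.
have := @mean_poly_cvg p => /cvgrPdist_le /(_ _ e4); apply: filterS => N.
rewrite ler_distl => /andP[_ H].
have := @mean_le (fun x => p.[x]) (fun x => (t <= x)%R%:R) (e / 4) N (ltW e4).
have lt x : Ir r x -> p.[x] <= (t <= x)%R%:R + e / 4.
  move=> Ix; have [/andP[p0 p1] _ pe] := Hp x Ix.
  have [tx|xt] /= := leP t x; first lra.
  by rewrite add0r; apply: pe; lra.
by move=> /(_ lt); lra.
Qed.

Lemma count_cvg (t e : R) : mu [set t] = 0%E -> 0 < e -> exists N0, forall N, (N0 <= N)%N ->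
  `|(\sum_(j < N) (t <= @xi N j)%R%:R) - N%:R * tail mu t| <= e * N%:R.
Proof.
move=> mut e0; have [N0 _ H] := filterI (freq_upper t e0) (freq_lower mut e0).
exists N0 => N /H[/= up lo]; have [->|Np] := posnP N.
  by rewrite big_ord0 mul0r subrr normr0 mulr0.
have Nn : 0 < (N%:R : R) by rewrite ltr0n.
rewrite -[X in `|X - _|](mulVKf (lt0r_neq0 Nn)) -/(mean N (fun x => (t <= x)%R%:R)).
rewrite -mulrBr normrM gtr0_norm // mulrC ler_pM2r // ler_distl.
by apply/andP; split; lra.
Qed.

Variable K' : nat.
Hypothesis mu0 : forall t, mu [set t] = 0%E.

Lemma count_upcells k e : (k <= K'.+1)%N -> 0 < e -> exists N0, forall N, (N0 <= N)%N ->
  `|(\sum_(j < N) (k <= idx r K' (@xi N j))%N%:R) - N%:R * fine (mu (upcells r K' k))|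
    <= e * N%:R.
Proof.
move=> kK e0; have [->|k0] := posnP k.
  exists 0%N => N _; rewrite upcells0 probability_setT /= mulr1 sumr_const card_ord.
  by rewrite subrr normr0 mulr_ge0 // ltW.
move: kK; rewrite leq_eqVlt => /predU1P[->|].
  exists 0%N => N _; rewrite upcellsK // measure0 /= mulr0 subr0 big1.
    by rewrite normr0 mulr_ge0 // ltW.
  by move=> j _; rewrite leqNgt ltn_ord.
rewrite ltnS => kK; have [N0 H] := count_cvg (mu0 (pt r K' k)) e0.
exists N0 => N /H; rewrite upcellsE //.
by under eq_bigr do rewrite -leq_idx //.
Qed.

Lemma count_cell (b : 'I_K'.+1) e : 0 < e -> exists N0, forall N, (N0 <= N)%N ->
  `|#|[pred j : 'I_N | idx r K' (xi j) == b]|%:R - N%:R * fine (mu (cell r b))|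
    <= e * N%:R.
Proof.
move=> e0; have e2 : 0 < e / 2 by rewrite divr_gt0.
have [N1 H1] := count_upcells (ltnW (ltn_ord b)) e2.
have [N2 H2] := count_upcells (ltn_ord b) e2.
exists (maxn N1 N2) => N; rewrite geq_max => /andP[/H1 {}H1 /H2 {}H2].
have -> : #|[pred j : 'I_N | idx r K' (xi j) == b]|%:R =
   (\sum_(j < N) (b <= idx r K' (@xi N j))%N%:R) -
   (\sum_(j < N) (b.+1 <= idx r K' (@xi N j))%N%:R) :> R.
  rewrite -sum1_card natr_sum big_mkcond -sumrB; apply: eq_bigr => j _.
  rewrite inE -val_eqE /=; case: ltngtP => _; rewrite ?subrr ?subr0 //.
have -> : fine (mu (cell r b)) = fine (mu (upcells r K' b)) - fine (mu (upcells r K' b.+1)).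
  have mC := measurable_cell r0 b; have mU := measurable_upcells K' r0 b.+1.
  have E : mu (upcells r K' b) = (mu (cell r b) + mu (upcells r K' b.+1))%E.
    rewrite (upcellsS r b); apply: measureU => //.
    by have := cell_upcells r b; rewrite disj_set2E => /eqP.
  move/(congr1 fine): E; rewrite fineD; first by move=> ->; rewrite addrK.
    by rewrite -(fin_prob mu mC).
  by rewrite -(fin_prob mu mU).
have -> (a a' x y z : R) : a - a' - z * (x - y) = (a - z * x) - (a' - z * y) by ring.
apply: le_trans (ler_normB _ _) _; lra.
Qed.

End Frequencies.

(** * Entropy and densities *)

(** The left side is the tangent at [c] of the convex function $u \ln u$; for [u > 0] the inequality
    is $\ln(c/u) \le c/u - 1$. *)
Lemma mul_ln_tangent (R : realType) (u c : R) : 0 <= u -> 0 < c ->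
  u * ln c + u - c <= u * ln u.
Proof.
move=> u0 c0; have [->|un] := eqVneq u 0; first by rewrite !mul0r add0r sub0r oppr_le0 ltW.
have up : 0 < u by rewrite lt_def un.
have cu : 0 < c / u by rewrite divr_gt0.
have : ln (c / u) <= c / u - 1.
  by have := @le_ln1Dx R (c / u - 1); rewrite ltrBrDl subrr addrC subrK; apply.
rewrite ln_div ?posrE // -(ler_pM2l up) !mulrBr mulr1 [u * (c / u)]mulrC divfK //; lra.
Qed.

Section Density.
Variables (R : realType) (r : R).
Hypothesis r0 : 0 < r.
Variable mu : probability (measurableTypeR R) R.
Hypothesis mu1 : prob_on_cube r mu.
Variable p : R -> R.
Hypothesis mu_p : is_density r mu p.
Local Notation mR := (measurableTypeR R).
Local Notation lam := (@lam R).

Lemma density_measurable (D : set mR) : measurable_fun D (p : mR -> R).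
Proof. by case: mu_p => + _; exact: measurable_funS. Qed.

Lemma density_ge0 x : 0 <= p x.
Proof. by case: mu_p => _ []. Qed.

Lemma densityE (A : set mR) : measurable A ->
  mu A = (\int[lam]_(x in A `&` Ir r) (p x)%:E)%E.
Proof. by case: mu_p => _ [_]; exact. Qed.

Lemma density_atomless t : mu [set t] = 0%E.
Proof.
rewrite densityE; last exact: measurable_set1.
apply: null_set_integral.
- by apply: measurable_capIr; exact: measurable_set1.
- by apply/measurable_EFinP; exact: density_measurable.
apply/eqP; rewrite eq_le measure_ge0 andbT -(lebesgue_measure_set1 t).
apply: le_measure; rewrite ?inE.
- by apply: measurable_capIr; exact: measurable_set1.
- exact: measurable_set1.
- exact: subIsetl.
Qed.

Lemma density_intg : intg r p.
Proof.
apply/integrableP; split.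
  by apply/measurable_EFinP; exact: density_measurable.
rewrite (eq_integral (fun x : mR => (p x)%:E)); last first.
  by move=> x _ /=; rewrite ger0_norm // density_ge0.
have := densityE (@measurable_Ir R r); rewrite setIid => <-.
by rewrite mu1 ltry.
Qed.

Lemma density_int1 (A : set mR) : measurable A -> fine (mu A) = int1 r A p.
Proof. by move=> mA; rewrite densityE. Qed.

Lemma mul_ln_measurable (D : set mR) : measurable_fun D (fun x : mR => p x * ln (p x)).
Proof.
have mp := @density_measurable D.
apply: measurable_funM => //.
by apply: measurableT_comp => //; exact: measurable_ln.
Qed.

Let f (x : mR) : \bar R := (p x * ln (p x))%:E.

(** The tangent at 1 gives $p \ln p \ge p - 1 \ge -1$ on an interval of finite length. In particular
    an entropy is never $+\infty$. *)
Lemma ent_funeneg_fin : (\int[lam]_(x in Ir r) f^\- x)%E \is a fin_num.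
Proof.
have mI := @measurable_Ir R r.
have mf : measurable_fun (Ir r : set mR) f.
  by apply/measurable_EFinP; exact: mul_ln_measurable.
rewrite ge0_fin_numE ?integral_ge0 //.
apply: (@le_lt_trans _ _ (\int[lam]_(x in Ir r) cst 1%E x)%E).
  apply: ge0_le_integral => //; first exact: measurable_funeneg.
  move=> x _; rewrite funenegE /f -EFinN -EFin_max lee_fin ge_max ler01 andbT.
  have := mul_ln_tangent (density_ge0 x) ltr01; rewrite ln1 mulr0 add0r.
  by have := density_ge0 x; lra.
rewrite integral_cst // mul1e; have lt : (lam (Ir r) < +oo)%E by rewrite lam_Ir // ltry.
exact: lt.
Qed.

Lemma ent_neqNy : (\int[lam]_(x in Ir r) f x)%E != -oo%E.
Proof.
rewrite integralE; have := ent_funeneg_fin.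
have : (0 <= \int[lam]_(x in Ir r) f^\+ x)%E by exact: integral_ge0.
case: (\int[lam]_(x in Ir r) f^\+ x)%E => //.
  by move=> a _; case: (\int[lam]_(x in Ir r) f^\- x)%E.
by move=> _; case: (\int[lam]_(x in Ir r) f^\- x)%E.
Qed.

Lemma density_ent_intg (v : R) :
  (\int[lam]_(x in Ir r) f x)%E = v%:E -> intg r (fun x => p x * ln (p x)).
Proof.
move=> fv; have mI := @measurable_Ir R r.
have mf : measurable_fun (Ir r : set mR) f.
  by apply/measurable_EFinP; exact: mul_ln_measurable.
have nf := ent_funeneg_fin.
have pos_fin : (\int[lam]_(x in Ir r) f^\+ x < +oo)%E.
  rewrite ltey; apply/eqP => posy; move: fv; rewrite integralE posy.
  by move: nf; case: (\int[lam]_(x in Ir r) f^\- x)%E.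
apply/integrableP; split => //.
rewrite (eq_integral (fun x : mR => (f^\+ x + f^\- x)%E)); last first.
  by move=> x _; have := congr1 (@^~ x) (fune_abse f).
rewrite ge0_integralD //; [|exact: measurable_funepos|exact: measurable_funeneg].
by apply: lte_add_pinfty => //; rewrite -ge0_fin_numE // integral_ge0.
Qed.

(** On each cell the tangent of $u \ln u$ at the mean density [q b / l] is integrated. *)
Lemma jensen_cells K' : intg r (fun x => p x * ln (p x)) ->
  (\sum_(b < K'.+1) fine (mu (cell r b)) * ln (fine (mu (cell r b)))) - ln (ell r K') <=
  int1 r setT (fun x => p x * ln (p x)).
Proof.
move=> ient; have ip := density_intg.
have l0 := ell_gt0 K' r0; have mC b := measurable_cell r0 (b : 'I_K'.+1).
pose q (b : 'I_K'.+1) := int1 r (cell r b) p.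
have qE (b : 'I_K'.+1) : fine (mu (cell r b)) = q b by exact: density_int1.
under eq_bigr do rewrite qE.
have q0 b : 0 <= q b.
  by rewrite -[leLHS](mul0r (mass r (cell r b))) -int1_cst //; apply: int1_le => //;
    [exact: intg_cst|move=> x _ _; exact: density_ge0].
have q1 : \sum_(b < K'.+1) q b = 1.
  have := int1_cells K' r0 measurableT ip; rewrite -density_int1 //.
  rewrite probability_setT /= => ->; apply: eq_bigr => b _; by rewrite setTI.
rewrite (int1_cells K' r0 measurableT ient).
have -> : \sum_(b < K'.+1) q b * ln (q b) - ln (ell r K') =
    \sum_(b < K'.+1) q b * (ln (q b) - ln (ell r K')).
  rewrite -[ln (ell r K') in LHS]mul1r -[1 in LHS]q1 mulr_suml -sumrB.
  by apply: eq_bigr => b _; rewrite mulrBr.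
have bound c b : 0 < c ->
    q b * ln c + q b - c * ell r K' <= int1 r (cell r b) (fun x => p x * ln (p x)).
  move=> c0.
  have -> : q b * ln c + q b - c * ell r K' =
      int1 r (cell r b) (fun x => (ln c + 1) * p x + cst (- c) x).
    rewrite int1D //; [|exact: intgZ|exact: intg_cst].
    by rewrite int1Z // int1_cst // (mass_cell r0) /q; ring.
  apply: int1_le => //; first by apply: intgD; [exact: intgZ|exact: intg_cst].
  by move=> x _ _ /=; have := mul_ln_tangent (density_ge0 x) c0; lra.
apply: ler_sum => b _; rewrite setTI.
have [E|qn] := eqVneq (q b) 0; last first.
  have qb : 0 < q b by rewrite lt_def qn q0.
  have := bound _ b (divr_gt0 qb l0); rewrite ln_div ?posrE // divfK ?gt_eqF //; lra.
(* A cell of mass 0 has mean density 0, where there is no tangent; those at [e / l] with [e]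
   arbitrarily small replace it. *)
rewrite E mul0r; apply/ler_addgt0Pr => e e0.
have := bound _ b (divr_gt0 e0 l0); rewrite E divfK ?gt_eqF //; lra.
Qed.

End Density.

(** The value $-\infty$ covers both a missing density and a density with $\int p \ln p =
    +\infty$. *)
Lemma entropy_cases (R : realType) (r : R) (mu : probability (measurableTypeR R) R) :
  0 < r -> entropy r mu = -oo%E \/ exists p v, [/\ is_density r mu p,
    (\int[@lam R]_(x in Ir r) (p x * ln (p x))%:E)%E = v%:E & entropy r mu = (- v)%:E].
Proof.
move=> r0; rewrite /entropy; case: pselect => [e|_]; last by left.
case: (cid e) => p mu_p /=; have := ent_neqNy r0 mu_p.
case E: (integral _ _ _) => [v||] // _; [right|by left].
by exists p, v; split.
Qed.

(** * Entropy of a measure with a positive continuous density *)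

Section GibbsEntropy.
Variables (R : realType) (r : R).
Hypothesis r0 : 0 < r.
Variable mu : probability (measurableTypeR R) R.
Hypothesis mu1 : prob_on_cube r mu.
Variable g : R -> R.
Hypothesis g_ucont : ucont g.
Hypothesis g_gt0 : forall x, 0 < g x.
Local Notation mR := (measurableTypeR R).
Local Notation lam := (@lam R).
Hypothesis mu_g : forall A : set mR, measurable A -> mu A = (int1 r A g)%:E.

Lemma ucont_density : is_density r mu g.
Proof.
split; first by apply: continuous_measurable_fun; exact: ucont_continuous.
split=> [x|A mA]; first exact: ltW.
by rewrite mu_g // -int1E //; exact: ucont_intg.
Qed.

Lemma mul_ln_continuous : continuous (fun x => g x * ln (g x)).
Proof.
move=> x; have cg := ucont_continuous g_ucont.
apply: cvgM; first exact: cg.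
by apply: continuous_comp; [exact: cg|exact: continuous_ln].
Qed.

(** [entropy] uses a density picked by choice; it equals [g] almost everywhere, since both have the
    same integrals over measurable sets. *)
Lemma entropy_ucont : entropy r mu = (- int1 r setT (fun x => g x * ln (g x)))%:E.
Proof.
rewrite /entropy; case: pselect => [e|[]]; last by exists g; exact: ucont_density.
case: (cid e) => p mu_p /=; rewrite EFinN; congr (- _)%E.
have mI := @measurable_Ir R r.
rewrite -int1E //; last by apply: continuous_intg; exact: mul_ln_continuous.
rewrite setTI; have dg := ucont_density; apply: ae_eq_integral => //.
- by apply/measurable_EFinP; exact: (mul_ln_measurable mu_p).
- by apply/measurable_EFinP; exact: (mul_ln_measurable dg).
have : ae_eq lam (Ir r) (EFin \o p) (EFin \o g).
  apply: integral_ae_eq => //.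
  - exact: (density_intg mu1 mu_p).
  - by apply/measurable_EFinP; exact: (density_measurable dg).
  move=> E EI mE; have EE : E = E `&` Ir r by apply/esym/setIidl.
  by rewrite EE -(densityE mu_p) // -(densityE dg).
by apply: filterS => x H Ix; have := H Ix => -[/= ->].
Qed.

(** Jensen reversed up to oscillation: on the cell of [x], [g] is at least $e^{-\varepsilon} g(x)$,
    whence $\ln g(x) \le \ln q_b - \ln l + \varepsilon$. *)
Lemma ent_cells_ge K' eps : 0 <= eps ->
  (forall x y, Ir r x -> Ir r y -> idx r K' x = idx r K' y -> ln (g x) <= ln (g y) + eps) ->
  int1 r setT (fun x => g x * ln (g x)) <=
  (\sum_(b < K'.+1) fine (mu (cell r b)) * ln (fine (mu (cell r b)))) - ln (ell r K') + eps.
Proof.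
move=> eps0 osc; have ig := ucont_intg r g_ucont.
have ient : intg r (fun x => g x * ln (g x)) by apply: continuous_intg; exact: mul_ln_continuous.
have l0 := ell_gt0 K' r0; have mC b := measurable_cell r0 (b : 'I_K'.+1).
pose q (b : 'I_K'.+1) := int1 r (cell r b) g.
have qE (b : 'I_K'.+1) : fine (mu (cell r b)) = q b by rewrite mu_g.
under eq_bigr do rewrite qE.
have q1 : \sum_(b < K'.+1) q b = 1.
  have := int1_cells K' r0 measurableT ig; have := mu_g measurableT.
  rewrite probability_setT => -[<-] ->; apply: eq_bigr => b _; by rewrite setTI.
rewrite (int1_cells K' r0 measurableT ient).
have -> : \sum_(b < K'.+1) q b * ln (q b) - ln (ell r K') + eps =
    \sum_(b < K'.+1) q b * (ln (q b) - ln (ell r K') + eps).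
  transitivity (\sum_(b < K'.+1) q b * ln (q b) + (\sum_(b < K'.+1) q b) * (eps - ln (ell r K'))).
    by rewrite q1; ring.
  by rewrite mulr_suml -big_split; apply: eq_bigr => b _ /=; ring.
apply: ler_sum => b _; rewrite setTI.
have -> : q b * (ln (q b) - ln (ell r K') + eps) =
    int1 r (cell r b) (fun x => (ln (q b) - ln (ell r K') + eps) * g x).
  by rewrite int1Z // mulrC.
apply: int1_le => //; first exact: intgZ.
move=> x xb Ix; rewrite mulrC ler_pM2r //.
have H : g x * expR (- eps) * ell r K' <= q b.
  rewrite -(mass_cell r0 b) -int1_cst //; apply: int1_le => //; first exact: intg_cst.
  move=> y yb Iy /=; rewrite -(ler_ln) ?posrE ?mulr_gt0 ?expR_gt0 //.
  rewrite lnM ?posrE ?expR_gt0 // expRK lerBlDr; apply: osc => //.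
  by rewrite xb yb.
have p0 : 0 < g x * expR (- eps) * ell r K' by rewrite !mulr_gt0 ?expR_gt0.
have := H; rewrite -ler_ln ?posrE //; last exact: lt_le_trans H.
by rewrite lnM ?posrE ?mulr_gt0 ?expR_gt0 // lnM ?posrE ?expR_gt0 // expRK; lra.
Qed.

End GibbsEntropy.

Section DensityMeasure.
Variables (R : realType) (r : R).
Hypothesis r0 : 0 < r.
Variable g : R -> R.
Hypothesis g_ucont : ucont g.
Hypothesis g_gt0 : forall x, 0 < g x.
Hypothesis g_int : int1 r setT g = 1.
Local Notation mR := (measurableTypeR R).
Local Notation lam := (@lam R).

Definition dens_measure (A : set mR) : \bar R :=
  (\int[lam]_(x in A `&` Ir r) (g x)%:E)%E.

Let dens0 : dens_measure set0 = 0%E.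
Proof. by rewrite /dens_measure set0I integral_set0. Qed.

Let dens_ge0 A : (0 <= dens_measure A)%E.
Proof. by apply: integral_ge0 => x _; rewrite lee_fin ltW. Qed.

Let dens_sigma : semi_sigma_additive dens_measure.
Proof.
move=> F mF tF mUF; rewrite /dens_measure setI_bigcupl.
have mI := @measurable_Ir R r.
have cg := ucont_continuous g_ucont.
apply: cvg_toP.
  apply: ereal_nondecreasing_is_cvgn => m n mn.
  by apply: lee_sum_nneg_natr => // k _ _; exact: dens_ge0.
rewrite ge0_integral_bigcup //=.
- by move=> k; exact: measurable_capIr.
- apply/measurable_EFinP; apply: measurable_funS (continuous_measurable_fun cg) => //.
- by move=> x _; rewrite lee_fin ltW.
- by apply: trivIset_setIr.
Qed.

(** Makes the density an actual probability, so that [tail_left] and uniqueness of measures apply to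
    it. *)
Lemma dens_probability : exists nu : probability mR R,
  forall A : set mR, measurable A -> nu A = (int1 r A g)%:E.
Proof.
pose m : {measure set mR -> \bar R} := HB.pack_for {measure set mR -> \bar R} dens_measure
  (isMeasure.Build _ _ _ dens_measure dens0 dens_ge0 dens_sigma).
have mE A : measurable A -> m A = (int1 r A g)%:E.
  by move=> mA; rewrite -int1E //; exact: ucont_intg.
have mT : m setT = 1%E by rewrite mE // g_int.
pose P : probability mR R := HB.pack_for (probability mR R) dens_measure m
  (Measure_isProbability.Build _ _ _ m mT).
by exists P.
Qed.

End DensityMeasure.

(** * A measure with the moments of a density *)

Section MomentUniqueness.
Variables (R : realType) (r : R).
Hypothesis r0 : 0 < r.
Variable mu : probability (measurableTypeR R) R.
Hypothesis mu1 : prob_on_cube r mu.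
Variable g : R -> R.
Hypothesis g_ucont : ucont g.
Hypothesis g_gt0 : forall x, 0 < g x.
Hypothesis g_int : int1 r setT g = 1.
Hypothesis moments : forall p : {poly R},
  Ex r mu (fun x => p.[x]) = int1 r setT (fun x => p.[x] * g x).
Local Notation mR := (measurableTypeR R).

Let ig : intg r g. Proof. exact: ucont_intg. Qed.

Let ipg (p : {poly R}) : intg r (fun x => p.[x] * g x).
Proof.
apply: continuous_intg => x; apply: cvgM; first exact: poly_continuous.
exact: (ucont_continuous g_ucont).
Qed.

Let split_ray t phi : intg r phi ->
  int1 r setT phi = int1 r (ray t) phi + int1 r (~` ray t) phi.
Proof.
move=> ip; rewrite -int1_setU ?setUv //; first exact: measurable_ray.
- by apply: measurableC; exact: measurable_ray.
- by rewrite disj_set2E setICr.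
Qed.

Lemma int1g_ge0 (A : set mR) : measurable A -> 0 <= int1 r A g.
Proof.
move=> mA; rewrite -[leLHS](mul0r (mass r A)) -int1_cst //.
by apply: int1_le => //; [exact: intg_cst|move=> x _ _; exact: ltW].
Qed.

Lemma int1g_le1 (A : set mR) : measurable A -> int1 r A g <= 1.
Proof.
move=> mA; rewrite -g_int -(setUv A) int1_setU //; last 2 first.
- exact: measurableC.
- by rewrite disj_set2E setICr.
by rewrite lerDl int1g_ge0 //; exact: measurableC.
Qed.

Lemma tail_le_density t dl e : 0 < dl -> 0 < e ->
  tail mu t <= int1 r (ray (t - dl)) g + 2 * e.
Proof.
move=> dl0 e0; have [p Hp /andP[H1 _]] := step_poly_tail r0 mu1 t dl0 e0.
have mr := measurable_ray (t - dl).
have H2 : int1 r setT (fun x => p.[x] * g x) <= int1 r (ray (t - dl)) g + e.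
  rewrite (split_ray (t - dl)) //; apply: lerD.
    apply: int1_le => // x _ Ix; have [/andP[_ p1] _ _] := Hp x Ix.
    by rewrite -[leRHS]mul1r ler_pM2r.
  have mC := measurableC mr.
  apply: (@le_trans _ _ (int1 r (~` ray (t - dl)) (fun x => e * g x))).
    apply: int1_le => //; first exact: intgZ.
    move=> x Cx Ix; have [_ _ pe] := Hp x Ix; rewrite ler_pM2r // pe // leNgt.
    apply/negP => xt; apply: Cx; rewrite /ray /= in_itv /= andbT; exact: ltW.
  by rewrite int1Z // ler_piMr ?(ltW e0) // int1g_le1.
rewrite moments in H1; lra.
Qed.

Lemma density_le_tail t dl e : 0 < dl -> 0 < e ->
  int1 r (ray t) g <= tail mu (t - dl) + 2 * e.
Proof.
move=> dl0 e0; have [p Hp /andP[_ H1]] := step_poly_tail r0 mu1 t dl0 e0.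
have mr := measurable_ray t.
have H2 : int1 r (ray t) g <= int1 r setT (fun x => p.[x] * g x) + e.
  rewrite (split_ray t (ipg p)).
  have C0 : 0 <= int1 r (~` ray t) (fun x => p.[x] * g x).
    have mC := measurableC mr.
    rewrite -[leLHS](mul0r (mass r (~` ray t))) -int1_cst //.
    apply: int1_le => //; first exact: intg_cst.
    by move=> x _ Ix; have [/andP[p0 _] _ _] := Hp x Ix; rewrite mulr_ge0 // ltW.
  have : int1 r (ray t) (fun x => (1 - e) * g x) <= int1 r (ray t) (fun x => p.[x] * g x).
    apply: int1_le => //; first exact: intgZ.
    move=> x tx Ix; have [_ pe _] := Hp x Ix; rewrite ler_pM2r // pe //.
    by move: tx; rewrite /ray /= in_itv /= andbT.
  rewrite int1Z //; have := int1g_le1 mr; have := int1g_ge0 mr.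
  move: (int1 r (ray t) g) => G; nra.
rewrite moments in H1; lra.
Qed.

(** By left continuity of both tails, [dl] and [e] can be sent to 0 in the two comparisons, so
    closed half-lines have equal masses; they are stable under intersection and generate the Borel
    sets. *)
Lemma moments_determine (A : set mR) : measurable A -> mu A = (int1 r A g)%:E.
Proof.
have [nu nuE] := dens_probability g_ucont g_gt0 g_int.
move=> mA; rewrite -nuE //.
have tailnu t : tail nu t = int1 r (ray t) g.
  by rewrite /tail nuE //; exact: measurable_ray.
have tailE' t : tail mu t = tail nu t.
  apply/eqP; rewrite eq_le; apply/andP; split; apply/ler_addgt0Pr => e e0.
    have [dl dl0 H] := tail_left nu t (divr_gt0 e0 (ltr0Sn _ 1)).
    have := tail_le_density t dl0 (divr_gt0 e0 (ltr0Sn _ 3)); rewrite -tailnu; lra.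
  have [dl dl0 H] := tail_left mu t (divr_gt0 e0 (ltr0Sn _ 1)).
  have := density_le_tail t dl0 (divr_gt0 e0 (ltr0Sn _ 3)); rewrite -tailnu; lra.
apply: (@measure_unique _ _ mR [set A | exists x, A = `[x, +oo[%classic]
   (fun k => `[- k%:R, +oo[%classic) _ _ _ _ mu nu) => //.
- exact: RGenCInfty.measurableE.
- move=> _ _ [x ->] [y ->]; exists (Num.max x y); apply/seteqP; split => z /=;
    rewrite !in_itv /= !andbT ge_max; first by case=> -> ->.
  by move=> /andP[].
- by move=> k; exists (- k%:R).
- apply/seteqP; split => // x _; exists (Num.truncn `|x|).+1 => //=.
  rewrite in_itv /= andbT lerNl; apply/ltW/(le_lt_trans _ (truncnS_gt _)).
  by rewrite -normrN; exact: ler_norm.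
- by move=> _ [x ->]; have := congr1 EFin (tailE' x); rewrite !tailE.
- by move=> k; apply: le_lt_trans (probability_le1 _ _) _; [exact: measurable_itv|exact: ltry].
Qed.

End MomentUniqueness.

(** * Discretization of the Gibbs weights *)

Lemma itr_upd (R : realType) (r : R) m (S : pred nat) A (F : (nat -> R) -> R) s i x :
  ~~ S i -> itr r m S A F (upd s i x) = itr r m S A (fun t => F (upd t i x)) s.
Proof.
move=> Si; elim: m s => //= m IH s; case Sm: (S m) => //.
apply: eq_int1 => y _ _; rewrite updC ?IH //.
by apply: contra Si => /eqP ->; rewrite Sm.
Qed.

Lemma uc_comp_upd (R : realType) (F : (nat -> R) -> R) i x : uc F ->
  uc (fun t => F (upd t i x)).
Proof.
move=> uF e /uF[d d0 H]; exists d => // s s' ss; apply: H => k; rewrite /upd.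
by case: eqP => // _; rewrite subrr normr0 ltW.
Qed.

Section Grid.
Variables (R : realType) (r : R) (n : nat) (h : 'rV[R]_n -> R).
Hypothesis r0 : 0 < r.
Hypothesis h_cont : {within cube r n, continuous h}.
Variable K' : nat.
Local Notation mR := (measurableTypeR R).
Local Notation allT := (fun _ : nat => setT : set mR).
Local Notation zs := (fun _ : nat => 0 : R).
Local Notation word := {ffun 'I_n -> 'I_K'.+1}.
Local Notation l := (ell r K').

Definition cellint (a : word) : R :=
  itr r n predT (fun k => cell r (wext ord0 a k)) (eh r h) zs.

(* Taking cell averages of [e^h] makes the discrete Gibbs weights [e^f] have exactly
   the cell masses of the continuous Gibbs measure, marginals included. *)
Definition gridfun (a : word) : R := ln (cellint a / l ^+ n).

Let uF := eh_uc r0 h_cont.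
Let l0 : 0 < l := ell_gt0 K' r0.
Let ln0 : 0 < l ^+ n. Proof. exact: exprn_gt0. Qed.

Lemma cellint_gt0 a : 0 < cellint a.
Proof.
apply: itr_eh_gt0 => // k; first exact: measurable_cell.
by rewrite mass_cell.
Qed.

Lemma expR_gridfun a : expR (gridfun a) = cellint a / l ^+ n.
Proof. by rewrite lnK // posrE divr_gt0 // cellint_gt0. Qed.

Lemma sum_gridfun : \sum_a expR (gridfun a) = partfun r h / l ^+ n.
Proof.
under eq_bigr do rewrite expR_gridfun.
rewrite -mulr_suml; congr (_ / _).
rewrite /partfun -(itr_words ord0 r0 n (B := fun _ (b : 'I_K'.+1) => cell r b)) //.
  by move=> k b; exact: measurable_cell.
move=> k phi uphi; rewrite (int1_cells K' r0 measurableT); last exact: ucont_intg.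
by apply: eq_bigr => b _; rewrite setTI.
Qed.

Lemma sum_gridfun_gt0 : 0 < \sum_a expR (gridfun a).
Proof. by rewrite sum_gridfun divr_gt0 // partfun_gt0. Qed.

Lemma ln_sum_gridfun : ln (\sum_a expR (gridfun a)) = pressure r h - n%:R * ln l.
Proof.
rewrite sum_gridfun ln_div ?posrE ?partfun_gt0 // -pressureE // lnXn //.
by rewrite mulr_natl.
Qed.

Lemma marg_gridfun (i : 'I_n) b :
  \sum_(a : word | a i == b) expR (gridfun a) =
  int1 r (cell r b) (gibbsdens r h i) * \sum_a expR (gridfun a).
Proof.
have mC b' := measurable_cell r0 (b' : 'I_K'.+1).
rewrite int1_gibbsdens // sum_gridfun expRN expR_pressure //.
have -> : (partfun r h)^-1 * int1 r (cell r b) (margfun r h i) * (partfun r h / l ^+ n) =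
    int1 r (cell r b) (margfun r h i) / l ^+ n.
  have P0 := partfun_gt0 r0 h_cont.
  by field; rewrite !gt_eqF.
under eq_bigr do rewrite expR_gridfun.
rewrite -mulr_suml; congr (_ / _); rewrite -margfun_int1 //.
(* Letters other than [b] at position [i] get the empty set, so the full sum over words in
   [itr_words] keeps only those with [a i = b]. *)
pose B (k : nat) (c : 'I_K'.+1) : set mR :=
  if (k == i) && (c != b) then set0 else cell r c.
have mB k c : measurable (B k c) by rewrite /B; case: ifP.
rewrite -(itr_words ord0 r0 n (B := B)) //; last 2 first.
- by move=> k; case: eqP.
- move=> k phi uphi; rewrite /B; have [_|_] := eqVneq k i => /=.
    rewrite (bigD1 b) //= eqxx /= big1 ?addr0 // => c ->.
    by rewrite /int1 set0I Rintegral_set0.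
  rewrite (int1_cells K' r0 measurableT); last exact: ucont_intg.
  by apply: eq_bigr => c _; rewrite setTI.
rewrite big_mkcond; apply: eq_bigr => a _; case: eqP => [aib|/eqP aib].
  apply: eq_itr => // k phi kn _ _; rewrite /B.
  have [ki|//] := eqVneq k i.
  by rewrite ki wext_ord aib eqxx.
apply/esym; rewrite (itr_swap r0 _ _ uF (ltn_ord i)) // /B eqxx wext_ord aib /=.
by rewrite /int1 set0I Rintegral_set0.
Qed.

Lemma cell_mass_gt0 (i : 'I_n) b : 0 < int1 r (cell r (b : 'I_K'.+1)) (gibbsdens r h i).
Proof.
have mC := measurable_cell r0 b.
rewrite int1_gibbsdens // mulr_gt0 ?expR_gt0 // -margfun_int1 //; apply: itr_eh_gt0 => // k.
  by case: eqP.
by case: eqP => _; rewrite ?mass_cell ?massT_gt0.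
Qed.

(** On the box of cells containing [x], [hc] stays within [eps] of its value at [x], and so does the
    logarithm of the mean of [eh]. *)
Lemma gridfun_close eps d : (forall s s', (forall k, `|s k - s' k| <= d) ->
    `|hc r h s - hc r h s'| <= eps) -> l <= d ->
  forall x : 'I_n -> R, (forall i, Ir r (x i)) ->
  `|h (\row_i x i) - gridfun [ffun i => idx r K' (x i)]| <= eps.
Proof.
move=> osc ld x Ix; set a := [ffun i => _].
(* The zeros from [n] on match the start sequence of [cellint], so [osc] can compare all entries. *)
pose s (k : nat) : R := if insub k is Some i then x i else 0.
have si (i : 'I_n) : s i = x i by rewrite /s valK.
have sn k : (n <= k)%N -> s k = 0 by move=> nk; rewrite /s insubF // ltnNge nk.
have d0 : 0 <= d by apply: le_trans ld; exact: ltW.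
have Is : seqIr r s.
  by move=> k; rewrite /s; case: insub => // *; exact: seqIr0.
have -> : h (\row_i x i) = hc r h s.
  by rewrite hc_row //; congr h; apply/rowP => i; rewrite !mxE si.
have near s' : (forall k, (k < n)%N && predT k -> cell r (wext ord0 a k) (s' k) /\ Ir r (s' k)) ->
    (forall k, ~~ ((k < n)%N && predT k) -> s' k = zs k) -> `|hc r h s' - hc r h s| <= eps.
  move=> h1 h2; apply: osc => k; have [kn|nk] := ltnP k n; last first.
    by rewrite h2 ?sn // ?ltnNge ?nk // subrr normr0.
  have [] := h1 k; first by rewrite kn.
  have /= -> := wext_ord ord0 a (Ordinal kn); rewrite ffunE /cell /= => ck Ik.
  apply: le_trans ld; apply: idx_close => //.
  by rewrite ck; have /= -> := si (Ordinal kn).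
have mC k : measurable (cell r (wext ord0 a k)) by exact: measurable_cell.
have massE' : \prod_(k < n | predT k) mass r (cell r (wext ord0 a k)) = l ^+ n.
  under eq_bigr do rewrite mass_cell //.
  by rewrite prodr_const card_ord.
have up : cellint a <= expR (hc r h s + eps) * l ^+ n.
  rewrite -massE'; apply: itr_le_mass => // s' h1 h2; rewrite ler_expR.
  by have := near s' h1 h2; rewrite ler_distl => /andP[].
have lo : expR (hc r h s - eps) * l ^+ n <= cellint a.
  rewrite -massE'; apply: itr_ge_mass => // s' h1 h2; rewrite ler_expR.
  by have := near s' h1 h2; rewrite ler_distl => /andP[].
have c0 : 0 < cellint a / l ^+ n by rewrite divr_gt0 // cellint_gt0.
rewrite distrC ler_distl; apply/andP; split.
  by rewrite -[leLHS]expRK ler_ln ?posrE ?expR_gt0 // ler_pdivlMr.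
by rewrite -[leRHS]expRK ler_ln ?posrE ?expR_gt0 // ler_pdivrMr.
Qed.

(** Moving coordinate [i] alone within a cell multiplies the integrand by at most [expR eps], hence
    also the integral over the other coordinates. *)
Lemma ln_gibbsdens_osc (i : 'I_n) eps d : (forall s s', (forall k, `|s k - s' k| <= d) ->
    `|hc r h s - hc r h s'| <= eps) -> l <= d ->
  forall x y, Ir r x -> Ir r y -> idx r K' x = idx r K' y ->
  ln (gibbsdens r h i x) <= ln (gibbsdens r h i y) + eps.
Proof.
move=> osc ld x y Ix Iy xy.
have d0 : 0 <= d by apply: le_trans ld; exact: ltW.
have m0 z := margfun_gt0 r0 h_cont i z.
have : margfun r h i x <= expR eps * margfun r h i y.
  rewrite /margfun !itr_upd /= ?eqxx // -itrZ //; last exact: uc_comp_upd.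
  have uG z : uc (fun t => eh r h (upd t i z)) by exact: uc_comp_upd.
  apply: itr_mono => //.
    move=> e e0; have [d' d'0 H] := uG y _ (divr_gt0 e0 (expR_gt0 eps)).
    exists d' => // s s' ss; rewrite -mulrBr normrM gtr0_norm ?expR_gt0 //.
    by rewrite mulrC -ler_pdivlMr ?expR_gt0 //; exact: H.
  move=> s' _ _; rewrite /eh -expRD ler_expR -lerBlDr.
  apply: le_trans (ler_norm _) _; apply: osc => k; rewrite /upd.
  case: eqP => _; last by rewrite subrr normr0.
  by apply: le_trans ld; exact: idx_close.
rewrite /gibbsdens !lnM ?posrE ?expR_gt0 // => H.
rewrite -addrA lerD2l addrC -[eps]expRK -lnM ?posrE ?expR_gt0 //.
by rewrite ler_ln ?posrE ?mulr_gt0 ?expR_gt0.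
Qed.

End Grid.

(** * Bounds on the mutual pressure *)

Lemma limn_esup_le (R : realType) (u : nat -> R) c N0 :
  (forall N, (N0 <= N)%N -> u N <= c) -> (limn_esup (fun N => (u N)%:E) <= c%:E)%E.
Proof.
move=> H; rewrite /limn_esup limf_esupE.
apply: ge_ereal_inf; exists (ereal_sup [set (u N)%:E | N in [set N | (N0 <= N)%N]]).
  by exists [set N | (N0 <= N)%N] => //; exists N0.
by apply: ge_ereal_sup => _ [N /= NN <-]; rewrite lee_fin; exact: H.
Qed.

Lemma limn_esup_ge (R : realType) (u : nat -> R) c N0 :
  (forall N, (N0 <= N)%N -> c <= u N) -> (c%:E <= limn_esup (fun N => (u N)%:E))%E.
Proof.
move=> H; rewrite /limn_esup limf_esupE; apply: le_ereal_inf_tmp => _ [V [N1 _ HV] <-].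
apply: (@le_trans _ _ (u (maxn N0 N1))%:E); first by rewrite lee_fin H // leq_maxl.
apply: ereal_sup_ubound; exists (maxn N0 N1) => //.
by apply: HV; rewrite /= leq_maxr.
Qed.

Section Approximation.
Variables (R : realType) (r : R) (n : nat).
Hypothesis r0 : 0 < r.
Variable mu : 'I_n -> probability (measurableTypeR R) R.
Hypothesis mu_cube : forall i, prob_on_cube r (mu i).
Variable Xi : forall N : nat, 'I_n -> 'I_N -> R.
Hypothesis Xi_approx : approx_seq r mu Xi.
Implicit Type h : 'rV[R]_n -> R.

Definition permavg h N : R := (N`!%:R ^+ n)^-1 *
  \sum_(s : {ffun 'I_n -> 'S_N})
    expR (\sum_(j < N) h (\row_(i < n) Xi i ((s i)^-1%g j))).

Lemma permavg_gt0 h N : 0 < permavg h N.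
Proof.
rewrite mulr_gt0 ?invr_gt0 ?exprn_gt0 ?ltr0n ?fact_gt0 //.
rewrite (bigD1 [ffun=> 1%g]) //= ltr_wpDr ?expR_gt0 // sumr_ge0 //.
Qed.

Lemma Xi_in N i (j : 'I_N) : Ir r (Xi i j).
Proof. by case: Xi_approx => H _; exact: H. Qed.

Section FixedGrid.
Variable K' : nat.

Definition Xiconf N : {ffun 'I_N -> {ffun 'I_n -> 'I_K'.+1}} :=
  [ffun j => [ffun i => idx r K' (Xi i j)]].

Definition cellprob i (b : 'I_K'.+1) : R := fine (mu i (cell r b)).

Lemma permavg_close h (f : {ffun 'I_n -> 'I_K'.+1} -> R) eps N :
  (forall x : 'I_n -> R, (forall i, Ir r (x i)) ->
    `|h (\row_i x i) - f [ffun i => idx r K' (x i)]| <= eps) ->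
  permavg h N <= expR (N%:R * eps) * avgexp f (Xiconf N) /\
  avgexp f (Xiconf N) <= expR (N%:R * eps) * permavg h N.
Proof.
move=> close.
have C0 : 0 < (N`!%:R ^+ n : R)^-1 by rewrite invr_gt0 exprn_gt0 // ltr0n fact_gt0.
have H (s : {ffun 'I_n -> 'S_N}) :
    `|(\sum_(j < N) h (\row_(i < n) Xi i ((s i)^-1%g j))) - energy f (shuffle s (Xiconf N))|
    <= N%:R * eps.
  rewrite /energy -sumrB; apply: le_trans (ler_norm_sum _ _ _) _.
  rewrite mulr_natl -[X in _ *+ X](card_ord N) -sumr_const; apply: ler_sum => j _.
  have := close (fun i => Xi i ((s i)^-1%g j)) (fun i => Xi_in _ _).
  congr (`|_ - f _| <= _); apply/ffunP => i; by rewrite !ffunE.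
by rewrite /permavg /avgexp; split; rewrite mulrCA ler_pM2l // mulr_sumr;
  apply: ler_sum => s _; rewrite -expRD ler_expR;
  have := H s; rewrite ler_distl => /andP[? ?]; lra.
Qed.

Lemma typical_Xiconf e : (forall i t, mu i [set t] = 0%E) -> 0 < e ->
  exists N0, forall N, (N0 <= N)%N -> typical cellprob e (Xiconf N).
Proof.
move=> mu0 e0; have [XiI [_ Xicvg]] := Xi_approx.
have H (ib : 'I_n * 'I_K'.+1) := @count_cell R r r0 (mu ib.1) (mu_cube ib.1)
  (fun N j => Xi ib.1 j) (fun N j => Xi_in ib.1 j) (@Xicvg ib.1) K' (mu0 ib.1) ib.2 e e0.
have [M HM] := choice H.
exists (\max_ib M ib) => N NM; apply/typicalP => i b.
have := HM (i, b) N; rewrite (leq_trans _ NM); last exact: leq_bigmax.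
move=> /(_ isT); rewrite /occ /=; congr (`|_%:R - _| <= _).
by apply: eq_card => j; rewrite !inE !ffunE.
Qed.

End FixedGrid.

Lemma mu_setT i : fine (mu i setT) = 1.
Proof. by rewrite probability_setT. Qed.

Lemma cellprob_sum K' i : \sum_b cellprob (K' := K') i b = 1.
Proof.
rewrite -(mu_setT i); have mC b := measurable_cell r0 (b : 'I_K'.+1).
have mU k := measurable_upcells K' r0 k.
pose u k := fine (mu i (upcells r K' k)).
rewrite (eq_bigr (fun b : 'I_K'.+1 => - (u b.+1 - u b))); last first.
  move=> b _; rewrite /u /cellprob.
  have E : mu i (upcells r K' b) = (mu i (cell r b) + mu i (upcells r K' b.+1))%E.
    rewrite (upcellsS r b); apply: measureU => //.
    by have := cell_upcells r b; rewrite disj_set2E => /eqP.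
  move/(congr1 fine): E; rewrite fineD; first by move=> ->; ring.
    by rewrite -(fin_prob (mu i) (mC b)).
  by rewrite -(fin_prob (mu i) (mU b.+1)).
rewrite -(big_mkord xpredT (fun k => - (u k.+1 - u k))) sumrN telescope_sumr // opprB.
by rewrite /u upcells0 upcellsK // measure0 subr0.
Qed.

Lemma cellprob_ge0 K' i b : 0 <= cellprob (K' := K') i b.
Proof. exact/fine_ge0/measure_ge0. Qed.

(** [w i] is $\int p \ln p$ for the density constant on cells. The [ln l] terms match those of
    [ln_sum_gridfun], so the exponential rate of [avgexp] becomes the pressure plus the sum of the
    [w i]. *)
Lemma qent_shift K' (w : 'I_n -> R) :
  (forall i, w i = (\sum_(b < K'.+1) cellprob i b * ln (cellprob i b)) - ln (ell r K')) ->
  qent (cellprob (K' := K')) - n%:R * ln (ell r K') = \sum_i w i.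
Proof.
move=> wE; rewrite /qent (eq_bigr (fun i => w i + ln (ell r K'))); last first.
  by move=> i _; rewrite wE subrK.
by rewrite big_split /= sumr_const card_ord mulr_natl addrK.
Qed.

Lemma permavg_upper h (p : 'I_n -> R -> R) (v : 'I_n -> R) eps :
  {within cube r n, continuous h} ->
  (forall i, is_density r (mu i) (p i)) ->
  (forall i, (\int[@lam R]_(x in Ir r) (p i x * ln (p i x))%:E)%E = (v i)%:E) -> 0 < eps ->
  exists N0, forall N, (N0 <= N)%N ->
    N%:R^-1 * ln (permavg h N) <= pressure r h + \sum_i v i + eps.
Proof.
(* One half of [eps] pays for replacing [h] by [gridfun], the other for the asymptotics of
   [avgexp]. *)
move=> h_cont dens pv eps0; have e2 : 0 < eps / 2 by rewrite divr_gt0.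
have [d d0 osc] := hc_uc r0 h_cont e2.
have [K' /(_ _ (leqnn K')) lK] := small_ell r0 d0.
have close := gridfun_close r0 h_cont osc lK.
have q0 i b := @cellprob_ge0 K' i b.
have [e e0 [N1 H1]] := avgexp_le_asymp (cellprob_sum K') (sum_gridfun_gt0 r0 h_cont K') q0 e2.
have atomless i t := density_atomless (dens i) t.
have [N2 H2] := @typical_Xiconf K' e atomless e0.
exists (maxn 1 (maxn N1 N2)) => N; rewrite !geq_max => /and3P[N0 /H1 {}H1 /H2 {}H2].
have [up _] := permavg_close N close.
have Np : 0 < (N%:R : R) by rewrite ltr0n.
rewrite mulrC ler_pdivrMr //.
have E0 := expR_gt0 (N%:R * (eps / 2) : R).
have := le_trans up (ler_wpM2l (ltW E0) (H1 _ H2)).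
rewrite -expRD -ler_ln ?posrE ?expR_gt0 ?permavg_gt0 // expRK => /le_trans; apply.
rewrite -mulrDr [leRHS]mulrC ler_pM2l // ln_sum_gridfun //.
have := qent_shift (K' := K') (fun i => erefl _).
have : \sum_i ((\sum_(b < K'.+1) cellprob i b * ln (cellprob i b)) - ln (ell r K')) <= \sum_i v i.
  apply: ler_sum => i _.
  have ient := density_ent_intg r0 (dens i) (pv i).
  apply: le_trans (jensen_cells r0 (mu_cube i) (dens i) K' ient) _.
  rewrite -lee_fin -int1E // setTI pv; exact: lexx.
lra.
Qed.

Lemma permavg_lower h eps : {within cube r n, continuous h} ->
  (forall i (A : set (measurableTypeR R)), measurable A ->
     mu i A = (int1 r A (gibbsdens r h i))%:E) -> 0 < eps ->
  exists N0, forall N, (N0 <= N)%N ->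
    pressure r h + \sum_i int1 r setT (fun x => gibbsdens r h i x * ln (gibbsdens r h i x)) - eps
    <= N%:R^-1 * ln (permavg h N).
Proof.
move=> h_cont mu_g eps0.
(* [n + 2] shares of [eps]: one for the oscillation of each marginal density, one for [gridfun], one
   for the asymptotics. *)
have n0 : 0 < (n.+2%:R : R) by rewrite ltr0n.
have e2 : 0 < eps / n.+2%:R by rewrite divr_gt0.
have [d d0 osc] := hc_uc r0 h_cont e2.
have [K' /(_ _ (leqnn K')) lK] := small_ell r0 d0.
have close := gridfun_close r0 h_cont osc lK.
have gu i := gibbsdens_ucont r0 h_cont i; have gp i x := gibbsdens_gt0 r0 h_cont i x.
have qE i b : cellprob (K' := K') i b = int1 r (cell r b) (gibbsdens r h i).
  by rewrite /cellprob mu_g //; exact: measurable_cell.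
have q0 i b : 0 < cellprob (K' := K') i b by rewrite qE; exact: cell_mass_gt0.
have marg i b : \sum_(a : {ffun 'I_n -> 'I_K'.+1} | a i == b) expR (gridfun r h a) =
    cellprob i b * \sum_(a : {ffun 'I_n -> 'I_K'.+1}) expR (gridfun r h a).
  by rewrite qE marg_gridfun.
have [e e0 [N1 H1]] :=
  avgexp_ge_asymp (cellprob_sum K') (sum_gridfun_gt0 r0 h_cont K') q0 marg e2.
have dens i := ucont_density (gu i) (gp i) (mu_g i).
have atomless i t := density_atomless (dens i) t.
have [N2 H2] := @typical_Xiconf K' e atomless e0.
exists (maxn 1 (maxn N1 N2)) => N; rewrite !geq_max => /and3P[N0 /H1 {}H1 /H2 {}H2].
have [_ lo] := permavg_close N close.
have Np : 0 < (N%:R : R) by rewrite ltr0n.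
rewrite [leRHS]mulrC ler_pdivlMr //.
have A0 := permavg_gt0 h N; have E0 := expR_gt0 (N%:R * (eps / n.+2%:R) : R).
have /= L := le_trans (H1 _ H2) lo.
rewrite -ler_ln ?posrE ?expR_gt0 ?(mulr_gt0 E0 A0) // lnM ?posrE // !expRK in L.
rewrite -lerBlDl in L; apply: le_trans L.
rewrite -mulrBr mulrC ler_pM2l // ln_sum_gridfun //.
have := qent_shift (K' := K') (fun i => erefl _).
have : \sum_i int1 r setT (fun x => gibbsdens r h i x * ln (gibbsdens r h i x)) <=
    \sum_i ((\sum_(b < K'.+1) cellprob i b * ln (cellprob i b)) - ln (ell r K') + eps / n.+2%:R).
  apply: ler_sum => i _; apply: (ent_cells_ge r0 (gu i) (gp i) (mu_g i)); first exact: ltW.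
  exact: (ln_gibbsdens_osc r0 h_cont i osc lK).
rewrite [X in _ <= X]big_split /= sumr_const card_ord -[_ *+ n]mulr_natr.
have : eps = eps / n.+2%:R * (n%:R + 2).
  by rewrite -natrD addn2 divfK // gt_eqF.
move: (eps / n.+2%:R) => x; lra.
Qed.

End Approximation.

(** * Tilting by a function of one coordinate *)

(** Division by [t] leaves [D <= C * t]; if [D] were positive, [t <= D / (2 * (C + 1))] would
    contradict it. *)
Lemma quadratic_slope_le0 (R : realType) (D M C : R) : 0 <= M -> 0 <= C ->
  (forall t, 0 < t -> t * M <= 1 / 2 -> t * D <= C * t ^+ 2) -> D <= 0.
Proof.
move=> M0 C0 H; rewrite leNgt; apply/negP => D0.
have M1 : 0 < 2 * (M + 1) by lra.
have C1 : 0 < 2 * (C + 1) by lra.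
pose t := Num.min (2 * (M + 1))^-1 (D / (2 * (C + 1))).
have t0 : 0 < t by rewrite lt_min invr_gt0 M1 divr_gt0.
have tM : t * M <= 1 / 2.
  apply: (@le_trans _ _ ((2 * (M + 1))^-1 * M)); first by rewrite ler_wpM2r // ge_min lexx.
  by rewrite mulrC ler_pdivrMr //; lra.
have tC : t * (2 * (C + 1)) <= D by rewrite -ler_pdivlMr // ge_min lexx orbT.
have := H t t0 tM; rewrite expr2 mulrCA ler_pM2l // => DC; nra.
Qed.

Section Variation.
Variables (R : realType) (r : R) (n : nat) (h : 'rV[R]_n -> R).
Hypothesis r0 : 0 < r.
Hypothesis h_cont : {within cube r n, continuous h}.
Variables (i : 'I_n) (p : {poly R}).
Local Notation mR := (measurableTypeR R).
Local Notation allT := (fun _ : nat => setT : set mR).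
Local Notation zs := (fun _ : nat => 0 : R).

Definition coordpoly (x : 'rV[R]_n) : R := p.[x ord0 i].
Definition tilt (t : R) (x : 'rV[R]_n) : R := h x + t * coordpoly x.

Lemma coordpoly_cont : {within cube r n, continuous coordpoly}.
Proof.
apply: continuous_subspaceT => x.
apply: (@continuous_comp _ _ _ (fun x : 'rV[R]_n => x ord0 i) (horner p)).
  exact: coord_continuous.
exact: continuous_horner.
Qed.

Lemma tilt_cont t : {within cube r n, continuous (tilt t)}.
Proof.
move=> x; apply: cvgD; first exact: h_cont.
by apply: cvgM; [exact: cvg_cst|exact: coordpoly_cont].
Qed.

Let ps (s : nat -> R) : R := hc r coordpoly s.
Let ps_uc : uc ps := hc_uc r0 coordpoly_cont.
Let uF : uc (eh r h) := eh_uc r0 h_cont.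

Lemma psE s : ps s = p.[clamp r (s i)].
Proof. by rewrite /ps /hc /coordpoly mxE. Qed.

Lemma ps_eh_uc : uc (fun s => ps s * eh r h s).
Proof.
have [M HM] := hc_bounded r0 coordpoly_cont; have [M' HM'] := hc_bounded r0 h_cont.
have M0 : 0 <= M by exact: le_trans (HM zs).
apply: (@uc_mul _ _ _ (M + expR M')) => // s.
  by apply: le_trans (HM s) _; rewrite lerDl expR_ge0.
rewrite ger0_norm ?expR_ge0 // -[leLHS]add0r lerD // ler_expR.
exact: le_trans (ler_norm _) (HM' s).
Qed.

Definition polyint : R := itr r n predT allT (fun s => ps s * eh r h s) zs.

Lemma polyintE : expR (- pressure r h) * polyint =
  int1 r setT (fun x => p.[x] * gibbsdens r h i x).
Proof.
have -> : polyint = int1 r setT (fun x => p.[clamp r x] * margfun r h i x).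
  rewrite /polyint (itr_swap r0 _ _ ps_eh_uc (ltn_ord i)) //; apply: eq_int1 => x _ _.
  rewrite itr_upd /= ?eqxx // /margfun itr_upd /= ?eqxx // -itrZ //.
    congr itr; apply/funext => t; rewrite psE upd_same //.
  exact: uc_comp_upd.
rewrite -int1Z //.
  by apply: eq_int1 => x _ Ix; rewrite clamp_id // /gibbsdens; ring.
have -> : (fun x => p.[clamp r x] * margfun r h i x) =
    (fun x => itr r n (predC1 (i : nat)) allT (fun s => ps s * eh r h s) (upd zs i x)).
  apply/funext => x; rewrite itr_upd /= ?eqxx // /margfun itr_upd /= ?eqxx // -itrZ //.
    congr itr; apply/funext => t; rewrite psE upd_same //.
  exact: uc_comp_upd.
by apply: intg_upd; apply: itr_uc => //; exact: ps_eh_uc.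
Qed.

(** Integrates $e^{tp} \le 1 + tp + 2t^2M^2$ against $e^h$, then applies $\ln(1+x) \le x$. *)
Lemma pressure_tilt_le t M : (forall s, `|ps s| <= M) -> `|t| * M <= 1 / 2 ->
  pressure r (tilt t) <= pressure r h + 2 * M ^+ 2 * t ^+ 2 +
    t * int1 r setT (fun x => p.[x] * gibbsdens r h i x).
Proof.
move=> HM tM; set c := 2 * M ^+ 2 * t ^+ 2.
have Z0 := partfun_gt0 r0 h_cont; have Z'0 := partfun_gt0 r0 (@tilt_cont t).
have u1 : uc (fun s => eh r h s + c * eh r h s) by exact: uc_lin.
have u2 : uc (fun s => (eh r h s + c * eh r h s) + t * (ps s * eh r h s)).
  by apply: uc_lin => //; exact: ps_eh_uc.
have le : partfun r (tilt t) <= partfun r h * (1 + (c + t * (polyint / partfun r h))).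
  have -> : partfun r h * (1 + (c + t * (polyint / partfun r h))) =
      itr r n predT allT (fun s => (eh r h s + c * eh r h s) + t * (ps s * eh r h s)) zs.
    rewrite itr_lin //; last exact: ps_eh_uc.
    rewrite itr_lin // -/polyint -/(partfun r h); field.
    by rewrite gt_eqF.
  apply: itr_mono => //; first exact: (eh_uc r0 (@tilt_cont t)).
  move=> s _ _; have -> : eh r (tilt t) s = eh r h s * expR (t * ps s) by rewrite -expRD.
  have tp : `|t * ps s| <= `|t| * M by rewrite normrM ler_wpM2l.
  have tp1 : t * ps s <= 1 / 2 by exact: le_trans (ler_norm _) (le_trans tp tM).
  have e0 : 0 < eh r h s by exact: expR_gt0.
  have := ler_wpM2l (ltW e0) (expR_le_quad tp1).
  have : 2 * (t * ps s) ^+ 2 <= c.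
    have -> : c = 2 * t ^+ 2 * M ^+ 2 by rewrite /c; ring.
    rewrite exprMn mulrA; apply: ler_wpM2l; first by rewrite mulr_ge0 ?sqr_ge0.
    rewrite -real_normK ?num_real //; apply: lerXn2r; rewrite ?nnegrE //.
    exact: le_trans (HM s).
  move=> /(ler_wpM2l (ltW e0)); lra.
have pos : 0 < 1 + (c + t * (polyint / partfun r h)).
  by rewrite -(pmulr_rgt0 _ Z0); exact: lt_le_trans le.
rewrite pressureE //; last exact: tilt_cont.
move: le; rewrite -ler_ln ?posrE ?mulr_gt0 // lnM ?posrE // => le.
apply: le_trans le _; rewrite -pressureE // -addrA lerD2l.
rewrite -polyintE expRN expR_pressure // [_^-1 * _]mulrC.
by apply: le_ln1Dx; lra.
Qed.

(** The parabola of [pressure_tilt_le] replaces differentiation: small [t] of both signs squeeze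
    [m]. *)
Lemma tangent_moment m : (forall t, pressure r h + t * m <= pressure r (tilt t)) ->
  m = int1 r setT (fun x => p.[x] * gibbsdens r h i x).
Proof.
move=> H; have [M HM] := hc_bounded r0 coordpoly_cont.
have M0 : 0 <= M by exact: le_trans (HM zs).
have C0 : 0 <= 2 * M ^+ 2 by rewrite mulr_ge0 ?sqr_ge0.
apply/eqP; rewrite eq_le -subr_le0 -[X in _ && X]subr_le0; apply/andP; split.
  apply: (quadratic_slope_le0 M0 C0) => t t0 tM.
  have tM' : `|t| * M <= 1 / 2 by rewrite gtr0_norm.
  by have := H t; have := pressure_tilt_le HM tM'; lra.
apply: (quadratic_slope_le0 M0 C0) => t t0 tM.
have tM' : `|- t| * M <= 1 / 2 by rewrite normrN gtr0_norm.
by have := H (- t); have := pressure_tilt_le HM tM'; rewrite sqrrN; lra.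
Qed.

End Variation.

(** * The inequality and its equality case *)

Section Main.
Variables (R : realType) (r : R) (n : nat).
Hypothesis r0 : 0 < r.
Variable h : 'rV[R]_n -> R.
Hypothesis h_cont : {within cube r n, continuous h}.
Variable mu : 'I_n -> probability (measurableTypeR R) R.
Hypothesis mu_cube : forall i, prob_on_cube r (mu i).
Variable Xi : forall N : nat, 'I_n -> 'I_N -> R.
Hypothesis Xi_approx : approx_seq r mu Xi.
Local Notation mR := (measurableTypeR R).

Lemma mutual_pressureE :
  mutual_pressure h Xi = limn_esup (fun N => (N%:R^-1 * ln (permavg Xi h N))%:E).
Proof. by []. Qed.

Lemma sum_entropyNy i : entropy r (mu i) = -oo%E ->
  (\sum_i entropy r (mu i) = -oo)%E.
Proof. by move=> E; rewrite (bigD1 i) //= E addNye. Qed.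

Lemma entropy_data : (exists i, entropy r (mu i) = -oo%E) \/
  exists p v, [/\ forall i, is_density r (mu i) (p i),
    forall i, (\int[@lam R]_(x in Ir r) (p i x * ln (p i x))%:E)%E = (v i)%:E &
    (\sum_i entropy r (mu i) = (- \sum_i v i)%:E)%E].
Proof.
have [|/forallNP nNy] := pselect (exists i, entropy r (mu i) = -oo%E); [by left|right].
have H i : exists pv : (R -> R) * R, [/\ is_density r (mu i) pv.1,
    (\int[@lam R]_(x in Ir r) (pv.1 x * ln (pv.1 x))%:E)%E = pv.2%:E &
    entropy r (mu i) = (- pv.2)%:E].
  by have [/nNy//|[p [v pv]]] := entropy_cases (mu i) r0; exists (p, v).
have [f Hf] := choice H.
exists (fun i => (f i).1), (fun i => (f i).2); split => [i|i|]; try by case: (Hf i).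
rewrite (eq_bigr (fun i => (- (f i).2)%:E)); last by move=> i _; case: (Hf i).
by rewrite sumEFin sumrN.
Qed.

Lemma mutual_pressure_le p v : (forall i, is_density r (mu i) (p i)) ->
  (forall i, (\int[@lam R]_(x in Ir r) (p i x * ln (p i x))%:E)%E = (v i)%:E) ->
  (mutual_pressure h Xi <= (pressure r h + \sum_i v i)%:E)%E.
Proof.
move=> dens pv; apply/lee_addgt0Pr => eps eps0; rewrite -EFinD mutual_pressureE.
have [N0 H] := permavg_upper r0 mu_cube Xi_approx h_cont dens pv eps0.
exact: limn_esup_le H.
Qed.

Lemma pressure_ge :
  (mutual_pressure h Xi + \sum_(i < n) entropy r (mu i) <= (pressure r h)%:E)%E.
Proof.
have [[i Ei]|[p [v [dens pv ->]]]] := entropy_data.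
  (* In the extended reals, adding $-\infty$ gives $-\infty$ whatever the mutual pressure is. *)
  by rewrite (sum_entropyNy Ei) addeNy leNye.
by rewrite EFinN leeBlDr // -EFinD; exact: mutual_pressure_le dens pv.
Qed.

(** A sum that sees a single coordinate is blind to the permutations. *)
Lemma sum_perm_row (q : R -> R) N (s : {ffun 'I_n -> 'S_N}) i :
  \sum_(j < N) q (Xi i ((s i)^-1%g j)) = \sum_(j < N) q (Xi i j).
Proof. by rewrite [RHS](reindex_inj (@perm_inj _ ((s i)^-1%g))). Qed.

Lemma permavg_tilt i (p : {poly R}) t N : permavg Xi (tilt h i p t) N =
  expR (t * \sum_(j < N) p.[Xi i j]) * permavg Xi h N.
Proof.
rewrite /permavg mulrCA; congr (_ * _); rewrite mulr_sumr; apply: eq_bigr => s _.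
rewrite -expRD; congr expR; rewrite /tilt big_split /= addrC; congr (_ + _).
rewrite -mulr_sumr /coordpoly -(sum_perm_row (horner p) s); congr (_ * _).
by apply: eq_bigr => j _; rewrite mxE.
Qed.

(* Tilting [h] by a function of one coordinate shifts the permutation averages by an
   explicit factor, so equality at [h] makes the tilted inequality tangent there. *)
Lemma pressure_eq_gibbs :
  (pressure r h)%:E = (mutual_pressure h Xi + \sum_(i < n) entropy r (mu i))%E ->
  forall (i : 'I_n) (A : set mR), measurable A ->
  mu i A = (int1 r A (gibbsdens r h i))%:E.
Proof.
have [[i Ei]|[p [v [dens pv ->]]]] := entropy_data.
  by rewrite (sum_entropyNy Ei) addeNy.
move=> PE i A mA; apply: (moments_determine r0 (mu_cube i)) => //.
- exact: gibbsdens_ucont.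
- by move=> x; exact: gibbsdens_gt0.
- exact: int1_gibbsdensT.
move=> q; apply: tangent_moment => // t.
apply/ler_addgt0Pr => eps eps0; have e2 : 0 < eps / 2 by rewrite divr_gt0.
have tc : {within cube r n, continuous (tilt h i q t)} by exact: tilt_cont.
have [N1 H1] := permavg_upper r0 mu_cube Xi_approx tc dens pv e2.
have [_ [_ /(_ i) Xicvg]] := Xi_approx.
have tcvg : (fun N => t * mean (fun N j => Xi i j) N (fun x => q.[x])) @ \oo -->
    t * Ex r (mu i) (fun x => q.[x]).
  by apply: cvgMr; exact: (mean_poly_cvg (mu_cube i) Xicvg).
have /cvgrPdist_le/(_ _ e2)[N2 _ H2] := tcvg.
have : (mutual_pressure h Xi <= (pressure r (tilt h i q t) + \sum_i v i + eps -
    t * Ex r (mu i) (fun x => q.[x]))%:E)%E.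
  rewrite mutual_pressureE; apply: (@limn_esup_le _ _ _ (maxn 1 (maxn N1 N2))) => N.
  rewrite !geq_max => /and3P[N0 /H1 {}H1 /H2 {}H2].
  have Np : 0 < (N%:R : R) by rewrite ltr0n.
  move: H1; rewrite permavg_tilt lnM ?posrE ?expR_gt0 ?permavg_gt0 // expRK mulrDr.
  move: H2; rewrite /= /mean ler_distl => /andP[_].
  by rewrite mulrCA; lra.
(* Equality with the real number $P(h)$ forces the mutual pressure to be finite. *)
move: PE; case: (mutual_pressure h Xi) => [m||] //=.
by rewrite -EFinD => -[->]; rewrite lee_fin; lra.
Qed.

Lemma gibbs_pressure_eq :
  (forall (i : 'I_n) (A : set mR), measurable A ->
    mu i A = (int1 r A (gibbsdens r h i))%:E) ->
  (pressure r h)%:E = (mutual_pressure h Xi + \sum_(i < n) entropy r (mu i))%E.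
Proof.
move=> mu_g; apply/eqP; rewrite eq_le pressure_ge andbT.
rewrite (eq_bigr (fun i => (- int1 r setT
    (fun x => gibbsdens r h i x * ln (gibbsdens r h i x)))%:E)); last first.
  move=> i _; apply: (entropy_ucont (mu_cube i)) => //.
  - exact: gibbsdens_ucont.
  - by move=> x; exact: gibbsdens_gt0.
  - exact: mu_g.
rewrite sumEFin sumrN EFinN leeBrDr // -EFinD.
apply/lee_addgt0Pr => eps eps0; rewrite -leeBlDr // -EFinB mutual_pressureE.
have [N0 H] := permavg_lower r0 mu_cube Xi_approx h_cont mu_g eps0.
exact: limn_esup_ge H.
Qed.

End Main.

Theorem theorem3p2 (R : realType) (r : R) (r_gt0 : 0 < r) (n : nat)
  (h : 'rV[R]_n -> R) (h_cont : {within cube r n, continuous h})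
  (mu : 'I_n -> probability (measurableTypeR R) R)
  (mu_cube : forall i, prob_on_cube r (mu i))
  (Xi : forall N : nat, 'I_n -> 'I_N -> R)
  (Xi_approx : approx_seq r mu Xi) :
  ((pressure r h)%:E >= mutual_pressure h Xi + \sum_(i < n) entropy r (mu i))%E /\
  ([<-> (pressure r h)%:E = (mutual_pressure h Xi + \sum_(i < n) entropy r (mu i))%E;
        forall (i : 'I_n) (A : set R), measurable A ->
          mu i A = gibbs_marginal r h i A;
        forall (i : 'I_n) (A : set R), measurable A ->
          mu i A = gibbs1 r (hmarg r h i) A]).
Proof.
split; first exact: pressure_ge.
tfae.
- move=> PE i A mA; rewrite gibbs_marginalE //.
  exact: (pressure_eq_gibbs r_gt0 h_cont mu_cube Xi_approx PE).
- by move=> H i A mA; rewrite H // gibbs1E // gibbs_marginalE.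
- move=> H; apply: gibbs_pressure_eq => // i A mA.
  by rewrite -gibbs1E //; exact: H.
Qed.
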